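(* Let $G=\mathbb{Z}^d$ for some integer $d\geq1$ and let $V$ be a finite group. Let $M\subset G$ be a finite subset and let $s\in\mathrm{Hom}_{grp}(V^M,V)^G$ be asymptotic to a constant configuration. Then it is decidable whether $\sigma_s$ is periodic, resp. eventually periodic.
   Context: For a group $G$ and a set $A$, $A^G$ is the set of maps (configurations) $G\to A$, and $G$ acts on it by $(gx)(h)=x(g^{-1}h)$. For $M\subset G$ and $s\in(A^{A^M})^G$, the non-uniform cellular automaton (NUCA) $\sigma_s\colon A^G\to A^G$ is $\sigma_s(x)(g)=s(g)((g^{-1}x)|_M)$. For a group $V$, $\mathrm{Hom}_{grp}(V^M,V)$ is the set of group homomorphisms $V^M\to V$. Two configurations are asymptotic if they coincide outside some finite subset of $G$. Thus $s$ is specified by finite data: $M$, a finite $E\subset G$, $s|_E$, and the common value of $s$ outside $E$; ''decidable'' means that there is an algorithm deciding the property from such data. $\sigma_s$ is periodic if there is an integer $n\ge1$ with $\sigma_s^n(x)=x$ for every $x\in V^G$; it is eventually periodic if there are integers $m,n\ge1$ with $\sigma_s^{n+m}(x)=\sigma_s^m(x)$ for all $x\in V^G$. *)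

(* Defs.v *)
From HB Require Import structures.
From mathcomp Require Import all_boot all_order all_fingroup all_algebra finmap.

Set Implicit Arguments.
Unset Strict Implicit.
Unset Printing Implicit Defensive.

Import GRing.Theory.

(** * Algorithms: Kleene's partial recursive functions *)

(* Programs are untyped with respect to arity: missing arguments are read as 0
   and superfluous ones are ignored, so a program denotes one partial recursive
   function of each arity. *)
Inductive recfun : Type :=
| Zero
| Succ
| Proj of nat
| Comp of recfun & seq recfun
| Prec of recfun & recfun
| Mu of recfun.

(* [run f v y]: the computation of [f] on the arguments [v] halts with value
   [y].  In [Prec], [z] lists the successive values of the recursion; in [Mu],
   all the values below [y] must be defined and nonzero. *)
Fixpoint run (f : recfun) (v : seq nat) (y : nat) {struct f} : Prop :=
  match f with
  | Zero => y = 0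
  | Succ => y = (head 0 v).+1
  | Proj i => y = nth 0 v i
  | Comp f gs =>
      exists2 w : seq nat,
        (fix runs (gs : seq recfun) (w : seq nat) {struct gs} : Prop :=
           match gs, w with
           | [::], [::] => True
           | g :: gs', a :: w' => run g v a /\ runs gs' w'
           | _, _ => False
           end) gs w
        & run f w y
  | Prec f g =>
      exists z : nat -> nat,
        [/\ run f (behead v) (z 0),
            forall k, k < head 0 v -> run g (k :: z k :: behead v) (z k.+1)
          & y = z (head 0 v)]
  | Mu f =>
      run f (y :: v) 0
      /\ forall k, k < y -> exists a, run f (k :: v) a.+1
  end.

Lemma run_det (f : recfun) (v : seq nat) (y y' : nat) :
  run f v y -> run f v y' -> y = y'.
Proof.
move: f v y y'.
fix IH 1; case=> [||i|f gs|f g|f] v y y' /=.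
- by move=> -> ->.
- by move=> -> ->.
- by move=> -> ->.
- case=> w rw ry [w' rw' ry'].
  suff eww : w = w' by move: ry'; rewrite -eww; exact: IH ry.
  elim: gs w w' rw rw' {ry ry'} => [|g gs IHgs] [|a w] [|a' w'] //=.
  by case=> ra rw [ra' rw']; rewrite (IH g _ _ _ ra ra') (IHgs _ _ rw rw').
- case=> z [z0 zS ->] [z' [z'0 z'S ->]].
  suff H k : k <= head 0 v -> z k = z' k by exact: H.
  elim: k => [_|k IHk ltk]; first exact: IH f _ _ _ z0 z'0.
  have := z'S _ ltk; rewrite -(IHk (ltnW ltk)); exact: IH g _ _ _ (zS _ ltk).
- case=> ry Hy [ry' Hy']; case: (ltngtP y y') => // lt.
  + by have [a ra] := Hy' _ lt; have := IH f _ _ _ ry ra.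
  + by have [a ra] := Hy _ lt; have := IH f _ _ _ ry' ra.
Qed.

Definition decides (f : recfun) (n : nat) (P : Prop) : Prop :=
  (P -> run f [:: n] 1) /\ (~ P -> run f [:: n] 0).

(** * Non-uniform cellular automata over Z^d *)

Section NUCA.

Variables (d : nat) (V : finGroupType).

(* The group Z^d, in additive notation. *)
Definition lattice := 'rV[int]_d.

Definition configuration := lattice -> V.

Definition shift (g : lattice) (x : configuration) : configuration :=
  fun h => x (- g + h)%R.

Definition restriction (M : {fset lattice}) (x : configuration) :
  {ffun M -> V} := [ffun m => x (val m)].

Definition local_map (M : {fset lattice}) := {ffun {ffun M -> V} -> V}.

(* The group law of V^M is the pointwise one of {ffun M -> V}. *)
Definition is_grp_hom (M : {fset lattice}) (f : local_map M) : Prop :=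
  {morph f : a b / (a * b)%g}.

Definition nuca (M : {fset lattice}) (s : lattice -> local_map M)
    (x : configuration) : configuration :=
  fun g => s g (restriction M (shift (- g)%R x)).

Definition periodic (F : configuration -> configuration) : Prop :=
  exists n : nat, 1 <= n /\ forall x, iter n F x =1 x.

Definition eventually_periodic (F : configuration -> configuration) : Prop :=
  exists m n : nat, [/\ 1 <= m, 1 <= n
    & forall x, iter (n + m) F x =1 iter m F x].

Definition coincide_outside (T : Type) (E : {fset lattice})
  (s t : lattice -> T) : Prop := forall g, g \notin E -> s g = t g.

(** * Goedel numbers of the finite data (M, E, s|_E, c) *)

(* [CodeSeq.code] is an effective bijection from [seq nat] to [nat]. *)

Definition code_int (z : int) : nat :=
  match z with Posz n => n.*2 | Negz n => n.*2.+1 end.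

Definition code_point (g : lattice) : nat :=
  CodeSeq.code [seq code_int (g 0%R i) | i : 'I_d].

Definition code_elt (v : V) : nat := enum_rank v.

(* The full table of a local map: one entry [f a; a m_1; ...; a m_k] for each
   pattern a in V^M, with m_1, ..., m_k in the order used in [code_data]. *)
Definition code_local_map (M : {fset lattice}) (f : local_map M) : nat :=
  CodeSeq.code
    [seq CodeSeq.code (code_elt (f a) :: [seq code_elt (a m) | m : M])
       | a : {ffun M -> V}].

Definition code_data (M E : {fset lattice}) (s : lattice -> local_map M)
    (c : local_map M) : nat :=
  CodeSeq.code
    [:: CodeSeq.code [seq code_point (val m) | m : M];
        CodeSeq.code [seq CodeSeq.code [:: code_point g; code_local_map (s g)]
                        | g <- enum_fset E];
        code_local_map c].

End NUCA.

(* Main.v *)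
Require Import Defs.
From HB Require Import structures.
From mathcomp Require Import all_boot all_order all_fingroup all_algebra finmap.
From mathcomp Require Import all_solvable mxabelem mpoly zify.
From Stdlib Require Import FunctionalExtensionality Classical.

Set Implicit Arguments.
Unset Strict Implicit.
Unset Printing Implicit Defensive.

Import GRing.Theory.

(* Far from the exceptional set, sigma_s coincides with the uniform automaton
   sigma_c, so it inherits identities between iterates from sigma_s.  Conversely,
   if sigma_c^N is idempotent, the iterates of sigma_s^N differ from each other
   only on a finite set, where they depend on finitely many sites; two of them
   coincide.  Hence sigma_s is eventually periodic iff sigma_c is, and periodic
   iff sigma_c is and no nontrivial finitely supported configuration, with
   support in an explicit finite set, is killed by sigma_s^N.

   Decidability for sigma_c follows from a bound N depending only on V: if a
   group automaton F over V is eventually periodic, then F^(2N) = F^N.  By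
   induction along fully invariant subgroups, V is perfect or elementary abelian.
   If V is perfect, images of distinct terms of the local rule commute, hence
   never cancel, and F is idempotent as soon as it is so on constants.  If
   V = F_p^n, then F is a matrix A over the Laurent polynomials; for N such that
   F^(2N) = F^N on constants, an idempotent power of D = A^(2N) - A^N kills
   constants, hence vanishes because shifts act unipotently on p^k-periodic
   configurations.  So D is nilpotent, D^n = 0 as the Laurent polynomials embed
   in a field, and the Frobenius gives A^(2 N p^n) = A^(N p^n). *)

(** * Group cellular automata *)

Lemma iter_periodic (T : Type) (f : T -> T) i j :
  i < j -> iter i f =1 iter j f ->
  forall k t, i <= k -> iter (k + t * (j - i)) f =1 iter k f.
Proof.
move=> ltij eij k t leik x.
have key : iter (t * (j - i) + i) f x = iter i f x.
  elim: t => [|t IH]; first by rewrite mul0n add0n.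
  by rewrite mulSn -addnA iterD IH -iterD subnK ?eij // ltnW.
rewrite (_ : k + _ = (k - i) + (t * (j - i) + i)); last by lia.
by rewrite iterD key -iterD subnK.
Qed.

(** The factorial of [m] lies beyond the preperiod [i] and is a multiple of the period [j - i]. It
    depends only on a bound for [j], hence serves many maps at once. *)
Lemma iter_idem_fact (T : Type) (f : T -> T) i j m :
  i < j <= m -> iter i f =1 iter j f ->
  iter (m`! + m`!) f =1 iter m`! f.
Proof.
move=> /andP[ltij lejm] eij.
have le_m : m <= m`!.
  by case: m {lejm} => // m; rewrite dvdn_leq ?fact_gt0 // dvdn_fact //=.
have /dvdnP[t Dt] : j - i %| m`!.
  by rewrite dvdn_fact // subn_gt0 ltij /= (leq_trans (leq_subr _ _)).
rewrite {2}Dt; apply: iter_periodic => //.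
exact: leq_trans (ltnW ltij) (leq_trans lejm le_m).
Qed.

Lemma iter_idem_mul (T : Type) (f : T -> T) n k :
  iter (n + n) f =1 iter n f -> 0 < k ->
  iter (k * n + k * n) f =1 iter (k * n) f.
Proof.
case: n => [|n] idf k0; first by rewrite muln0.
have le1 : n.+1 < n.+1 + n.+1 by rewrite -addSnnS ltn_addr.
have e : iter n.+1 f =1 iter (n.+1 + n.+1) f by move=> x; rewrite idf.
have := @iter_periodic _ f _ _ le1 e (k * n.+1) k; rewrite addnK.
by apply; rewrite leq_pmull.
Qed.

Lemma pigeonhole_seq (T : eqType) (f : nat -> T) (L : seq T) :
  (forall i, f i \in L) -> exists i j, i < j <= size L /\ f i = f j.
Proof.
move=> fL; have /(uniqPn (f 0)) : ~~ uniq (mkseq f (size L).+1).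
  apply/negP => u; have /(uniq_leq_size u) : {subset mkseq f (size L).+1 <= L}.
    by move=> _ /mapP[i _ ->].
  by rewrite size_mkseq ltnn.
rewrite size_mkseq => -[i [j [lij ltj]]].
rewrite !nth_mkseq ?(ltn_trans lij) // => e.
by exists i, j; rewrite lij.
Qed.

Lemma iter_small (T : Type) (f : T -> T) m k :
  0 < k -> iter (k + m) f =1 iter m f ->
  forall j, exists2 i, i < k + m & iter j f =1 iter i f.
Proof.
move=> k0 e j; have [lt|le] := ltnP j (k + m); first by exists j.
have lt : m < k + m by rewrite -[m in m < _]add0n ltn_add2r.
exists (m + (j - m) %% k); first by rewrite addnC ltn_add2r ltn_mod.
have := iter_periodic lt (fun x => esym (e x)) ((j - m) %/ k) (leq_addr ((j - m) %% k) m).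
rewrite addnK -addnA (addnC (_ %% k)) -divn_eq subnKC //.
by apply: leq_trans le; rewrite leq_addl.
Qed.

(** The iterates of [f] are self-maps of [T], so two of them coincide within a bound that does not
    depend on [f]. *)
Lemma finfun_idem (T : finType) :
  exists2 n, 0 < n & forall f : T -> T, iter (n + n) f =1 iter n f.
Proof.
exists (factorial #|{ffun T -> T}|); first exact: fact_gt0.
move=> f; pose u i : {ffun T -> T} := [ffun x => iter i f x].
have [i [j []]] : exists i j, i < j <= size (enum {ffun T -> T}) /\ u i = u j.
  by apply: pigeonhole_seq => i; rewrite mem_enum.
rewrite -cardT => lij e.
apply: iter_idem_fact lij _ => x.
by have /ffunP/(_ x) := e; rewrite !ffunE.
Qed.

(** * Automata as finite products of local endomorphisms *)

Section Gca.

Variables (d : nat) (V : finGroupType).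
Local Notation conf := (configuration d V).
Local Notation G := 'rV[int]_d.
Implicit Types (F H : conf -> conf) (x y : conf) (a b c g h : G) (v w : V).

(** Continuous group endomorphisms of the full shift that commute with translations. Locality is
    asked at the origin only, since translations carry it to every site. *)
Definition gca F : Prop :=
  [/\ forall x y g, F (fun k => (x k * y k)%g) g = (F x g * F y g)%g,
      forall x h g, F (fun k => x (k + h)%R) g = F x (g + h)%R
    & exists S : seq G, forall x y, {in S, x =1 y} -> F x 0%R = F y 0%R].

(** Unlike in [eventually_periodic], iterates are compared as configurations rather than site by
    site, and the preperiod [m] may be 0. *)
Definition evper F : Prop :=
  exists m n, 0 < n /\ iter (n + m) F =1 iter m F.

Lemma gca_comp F H : gca F -> gca H -> gca (F \o H).
Proof.
case=> FM FS [S FL] [HM HS [T HL]]; split=> /=.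
- move=> x y g.
  have -> : H (fun k => (x k * y k)%g) = fun k => (H x k * H y k)%g.
    by apply: functional_extensionality => k; rewrite HM.
  by rewrite FM.
- move=> x h g.
  have -> : H (fun k => x (k + h)%R) = fun k => H x (k + h)%R.
    by apply: functional_extensionality => k; rewrite HS.
  by rewrite FS.
- exists [seq (t + s)%R | t <- T, s <- S] => x y exy.
  apply: FL => s Ss; rewrite -[s]add0r -!HS; apply: HL => t Tt.
  by apply: exy; apply: allpairs_f.
Qed.

Lemma gca_id : gca id.
Proof. by split=> //; exists [:: 0%R] => x y; apply; rewrite inE. Qed.

Lemma gca_iter n F : gca F -> gca (iter n F).
Proof.
move=> cF; elim: n => [|n IH]; first exact: gca_id.
exact: (gca_comp cF IH).
Qed.

Definition delta a v : conf := fun g => if g == a then v else 1%g.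
Definition erase a x : conf := fun g => if g == a then 1%g else x g.
(** The contribution of state [v] at site [a] to the value at the origin. For a group automaton
    these are endomorphisms of [V], the coefficients of [F]. *)
Definition rule F a v : V := F (delta a v) 0%R.

Section Basics.

Variable F : conf -> conf.
Hypothesis cF : gca F.

Lemma gcaM x y : F (fun k => (x k * y k)%g) = fun k => (F x k * F y k)%g.
Proof. by case: cF => FM _ _; apply: functional_extensionality => g; rewrite FM. Qed.

Lemma gca_shift x h g : F (fun k => x (k + h)%R) g = F x (g + h)%R.
Proof. by case: cF. Qed.

Lemma gca1 : F (fun=> 1%g) = fun=> 1%g.
Proof.
apply: functional_extensionality => g.
have := congr1 (@^~ g) (gcaM (fun=> 1%g) (fun=> 1%g)).
rewrite (_ : (fun _ => _) = fun=> 1%g); last first.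
  by apply: functional_extensionality => k; rewrite mulg1.
by rewrite -{1}[F _ g]mulg1 => /mulgI.
Qed.

Lemma delta_out a v g : g != a -> delta a v g = 1%g.
Proof. by rewrite /delta => /negPf->. Qed.

Lemma deltaM a v w : delta a (v * w) = fun g => (delta a v g * delta a w g)%g.
Proof.
by apply: functional_extensionality => g; rewrite /delta; case: eqP; rewrite ?mulg1.
Qed.

Lemma ruleM a : {morph rule F a : v w / (v * w)%g}.
Proof. by move=> v w; rewrite /rule deltaM gcaM. Qed.

Lemma rule1 a : rule F a 1 = 1%g.
Proof.
rewrite /rule (_ : delta a 1 = fun=> 1%g) ?gca1 //.
by apply: functional_extensionality => g; rewrite /delta if_same.
Qed.

(** Configurations with disjoint supports commute pointwise, and a homomorphism preserves this. All
    commutation between coefficients comes from here. *)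
Lemma commute_disjoint x y g :
  (forall k, x k = 1%g \/ y k = 1%g) -> commute (F x g) (F y g).
Proof.
move=> dxy; have := congr1 (@^~ g) (gcaM x y); have := congr1 (@^~ g) (gcaM y x).
rewrite /commute /= => <- <-; congr (F _ g).
by apply: functional_extensionality => k; case: (dxy k) => ->; rewrite mulg1 mul1g.
Qed.

Lemma split_site a x : x = fun g => (delta a (x a) g * erase a x g)%g.
Proof.
apply: functional_extensionality => g; rewrite /delta /erase.
by case: eqP => [->|_]; rewrite ?mulg1 ?mul1g.
Qed.

Lemma gca_split a x : F x 0%R = (rule F a (x a) * F (erase a x) 0%R)%g.
Proof. by rewrite {1}(split_site a x) gcaM. Qed.

Lemma commute_rule_erase a v x : commute (rule F a v) (F (erase a x) 0%R).
Proof.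
by apply: commute_disjoint => k; rewrite /delta /erase; case: eqP => _; [right | left].
Qed.

Lemma commute_rule a b v w : a != b -> commute (rule F a v) (rule F b w).
Proof.
move=> ne; apply: commute_disjoint => k; rewrite /delta; case: (eqVneq k a) => [->|_].
  by right; rewrite (negPf ne).
by left.
Qed.

Lemma rule_delta a b v : F (delta a v) b = rule F (a - b)%R v.
Proof.
rewrite /rule -[in LHS](add0r b) -gca_shift; congr (F _ _).
apply: functional_extensionality => k; rewrite /delta.
by rewrite -(inj_eq (addIr b) k) subrK.
Qed.

(** Sites are split off one at a time by [gca_split]. Every duplicate-free list containing [S] is
    allowed, so that two automata can be expanded over a common list. *)
Lemma gca_supp : exists2 S : seq G, uniq S &
  forall T, uniq T -> {subset S <= T} ->
  forall x, F x 0%R = (\prod_(a <- T) rule F a (x a))%g.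
Proof.
case: (cF) => _ _ [S FL]; exists (undup S); first exact: undup_uniq.
move=> T uT sST x.
(* Truncating [x] to [T] first frees the induction on [T] from the memory set. *)
rewrite (FL _ (fun g => if g \in T then x g else 1%g)); last first.
  by move=> a Sa /=; rewrite sST ?mem_undup.
elim: T uT {sST} => [_|a T IH /= /andP[aT uT]].
  by rewrite big_nil -[LHS]/(F (fun=> 1%g) 0%R) gca1.
rewrite big_cons -IH // (gca_split a) inE eqxx /=; congr (_ * F _ _)%g.
apply: functional_extensionality => g; rewrite /erase inE.
by case: eqP => [->|//]; rewrite (negPf aT).
Qed.

Lemma gca_ind (P : V -> Prop) x :
  P 1%g -> (forall v w, P v -> P w -> P (v * w)%g) ->
  (forall a, P (rule F a (x a))) -> P (F x 0%R).
Proof.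
move=> P1 PM Pr; have [S uS /(_ S uS (fun _ => id) x)->] := gca_supp.
exact: big_ind.
Qed.

End Basics.

Lemma gca_ext F H : gca F -> gca H -> rule F =2 rule H -> F =1 H.
Proof.
move=> cF cH eFH x; apply: functional_extensionality => g.
rewrite -[g]add0r -!gca_shift //; move: (fun k => x (k + g)%R) => {}x.
have [S uS FS] := gca_supp cF; have [T uT HT] := gca_supp cH.
have uU : uniq (undup (S ++ T)) by exact: undup_uniq.
rewrite (FS _ uU) ?(HT _ uU); first by apply: eq_bigr => a _; rewrite eFH.
  by move=> a Ta; rewrite mem_undup mem_cat Ta orbT.
by move=> a Sa; rewrite mem_undup mem_cat Sa.
Qed.

Lemma evper_iter n F : evper F -> 0 < n -> evper (iter n F).
Proof.
case=> m [k [k0 e]] n0; exists m, k; split => // x.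
rewrite -!iterM mulnDl.
have lt : m < k + m by rewrite -[m in m < _]add0n ltn_add2r.
have := iter_periodic lt (fun x => esym (e x)) n (leq_pmulr m n0).
by rewrite addnK => /(_ x) <-; congr iter; nia.
Qed.

(* F has only finitely many distinct iterates. *)
Lemma evper_supp F : gca F -> evper F ->
  exists S : seq G, forall n a v, a \notin S -> rule (iter n F) a v = 1%g.
Proof.
move=> cF [m [k [k0 e]]].
have [S HS] : exists S : seq G, forall n a v, n < k + m -> a \notin S ->
    rule (iter n F) a v = 1%g.
  elim: (k + m) => [|l [S HS]]; first by exists [::].
  have [_ _ [T HT]] := gca_iter l cF.
  exists (S ++ T) => n a v; rewrite mem_cat negb_or ltnS leq_eqVlt.
  case/orP => [/eqP->|ltn] /andP[aS aT]; last exact: HS.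
  rewrite /rule (HT _ (fun=> 1%g)) ?(gca1 (gca_iter l cF)) //.
  by move=> b Tb; rewrite delta_out //; apply: contraNneq aT => <-.
exists S => n a v aS; have [i ltik ei] := iter_small k0 e n.
by rewrite /rule ei; apply: HS.
Qed.

(** The exponent is chosen before [F]: eventual periodicity of a uniform automaton thereby becomes
    one fixed identity that can be tested. *)
Definition bounded_evper : Prop :=
  exists2 n, 0 < n & forall F, gca F -> evper F -> iter (n + n) F =1 iter n F.

(* On constant configurations F acts as a self-map of the finite set V. *)
Lemma gca_const_idem : exists2 n, 0 < n & forall F, gca F -> forall v,
  iter (n + n) F (fun=> v) = iter n F (fun=> v).
Proof.
have [n n0 idn] := finfun_idem V; exists n => // F cF v.
pose f v := F (fun=> v) 0%R.
have e k w : iter k F (fun=> w) = fun=> iter k f w.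
  elim: k => //= k ->; apply: functional_extensionality => g.
  by rewrite /f -[in LHS](add0r g) -gca_shift.
by rewrite !e idn.
Qed.

End Gca.

(** * Perfect groups *)

(** The image is abelian, so the kernel contains the derived subgroup, which is all of [V]. *)
Lemma perfect_hom_trivial (V : finGroupType) (z : V -> V) :
  ([set: V]^`(1) = [set: V])%g -> {morph z : v w / (v * w)%g} ->
  (forall v w, commute (z v) (z w)) -> forall v, z v = 1%g.
Proof.
move=> perf zM zC v.
have zM' : {in [set: V] &, {morph z : v w / (v * w)%g}} by move=> a b _ _; exact: zM.
pose f := Morphism zM'.
have abf : abelian (f @* [set: V])%g.
  apply/centsP => _ /morphimP[a _ _ ->] _ /morphimP[b _ _ ->]; exact: zC.
have : (f v \in f @* ([set: V]^`(1)))%g by rewrite perf mem_morphim ?inE.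
by rewrite morphim_der // (derG1P abf) => /set1P.
Qed.

Section Perfect.

Variables (d : nat) (V : finGroupType).
Local Notation conf := (configuration d V).
Local Notation G := 'rV[int]_d.
Hypothesis perf : ([set: V]^`(1) = [set: V])%g.

Variable F : conf -> conf.
Hypotheses (cF : gca F) (eF : evper F).
Hypothesis idC : forall v, F (F (fun=> v)) = F (fun=> v).

Local Notation r := (rule F).
Local Notation rest a x := (F (erase a x) 0%R).

Let rb v := F (fun=> v) 0%R.

Let F_const v : F (fun=> v) = fun=> rb v.
Proof. by apply: functional_extensionality => g; rewrite -[g]add0r -gca_shift. Qed.

Let rbM : {morph rb : v w / (v * w)%g}.
Proof.
move=> v w; have := congr1 (@^~ 0%R) (gcaM cF (fun=> v) (fun=> w)).
by [].
Qed.

(** Splitting both sides of [rb v = rb (rb v)] at [a] expresses the quotient [z] of the two values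
    through values of [rest], which commute with the image of [r a]. Hence [z] is a homomorphism
    with commuting values, and perfectness makes it trivial. *)
Let r_rb a v : r a (rb v) = r a v.
Proof.
pose z v := ((r a (rb v))^-1 * r a v)%g.
have zE w : z w = (rest a (fun=> rb w) * (rest a (fun=> w))^-1)%g.
  have e1 : rb w = (r a w * rest a (fun=> w))%g := gca_split cF a (fun=> w).
  have e2 : rb w = (r a (rb w) * rest a (fun=> rb w))%g.
    by have := gca_split cF a (fun=> rb w); rewrite -{1}F_const idC F_const.
  by rewrite /z; apply: (mulgI (r a (rb w))); rewrite mulKVg mulgA -e2 e1 mulgK.
have zC w u : commute (z w) (r a u).
  rewrite zE; apply/commute_sym/commuteM; first exact: commute_rule_erase.
  by apply: commuteV; exact: commute_rule_erase.
have zM : {morph z : v w / (v * w)%g}.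
  move=> w u; rewrite [in RHS]/z [RHS]mulgA -/(z w) (commuteV (zC w (rb u))).
  by rewrite /z rbM !ruleM // invMg !mulgA.
have zz w u : commute (z w) (z u).
  by rewrite {2}/z; apply: commuteM; rewrite //; apply: commuteV.
have := perfect_hom_trivial perf zM zz v.
by move/(canRL (mulKVg _)); rewrite mulg1.
Qed.

(* Distinct words of the same length have commuting images, so a trivial
   product of perfect images has only trivial factors. *)
Let no_cancel (psi f : V -> V) b (x : V -> conf) :
  {morph psi : v w / (v * w)%g} -> {morph f : v w / (v * w)%g} ->
  (forall v, psi (r b (f v) * rest b (x v))%g = 1%g) ->
  forall v, psi (r b (f v)) = 1%g.
Proof.
move=> psiM fM e; apply: (perfect_hom_trivial perf).
  by move=> v w; rewrite fM ruleM // psiM.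
have psiC v w : commute v w -> commute (psi v) (psi w).
  by rewrite /commute -!psiM => ->.
move=> v w.
have -> : psi (r b (f w)) = ((psi (rest b (x w)))^-1)%g.
  by have := e w; rewrite psiM => /(canRL (mulgK _)); rewrite mul1g.
by apply: commuteV; apply: psiC; exact: commute_rule_erase.
Qed.

(** By [r_rb], the value at [w] is also [r a (r c w)] times the inverse of the image of a [rest b].
    Both factors commute with every [r a (r b (r c u))]: the first because [b != c], the second by
    disjointness of supports. *)
Let r_rrr a b c v : b != c -> r a (r b (r c v)) = 1%g.
Proof.
move=> ne; apply: (perfect_hom_trivial perf (z := fun v => r a (r b (r c v)))).
  by move=> u w /=; rewrite !ruleM.
move=> u w /=.
have rC y z : commute y z -> commute (r a y) (r a z).
  by rewrite /commute -!ruleM // => ->.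
have -> : r a (r b (r c w)) =
    (r a (r c w) * (r a (rest b (fun=> r c w)))^-1)%g.
  by rewrite -(r_rb a (r c w)) /rb (gca_split cF b) ruleM // mulgK.
apply: commuteM; first by apply/rC/commute_rule.
by apply/commuteV/rC/commute_rule_erase.
Qed.

(** Expand [v] as [rb v] inside [r b]: by [r_rrr] only the factor [r b v] survives. *)
Let r_idem a b v : r a (r b (r b v)) = r a (r b v).
Proof.
rewrite -[in RHS](r_rb b v) /rb (gca_split cF b) !ruleM // -[LHS]mulg1.
congr (_ * _)%g; symmetry.
apply: (gca_ind cF (P := fun y => r a (r b y) = 1%g)).
- by rewrite !rule1.
- by move=> y z ey ez; rewrite !ruleM // ey ez mulg1.
- by move=> c; rewrite /erase; case: eqVneq => [_|ne]; rewrite ?rule1 // r_rrr // eq_sym.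
Qed.

Let loop b k v := rule (iter k F) (b *+ k)%R v.

(** Splitting the outermost [F] at [b] isolates the factor [r b (loop b k v)], and [no_cancel]
    forbids the other terms from compensating it. *)
Let loopS (psi : V -> V) b k : {morph psi : v w / (v * w)%g} ->
  (forall v, psi (loop b k.+1 v) = 1%g) -> forall v, psi (r b (loop b k v)) = 1%g.
Proof.
move=> psiM e; have cFk := gca_iter k cF.
apply: (@no_cancel psi (loop b k) b (fun v => iter k F (delta (b *+ k.+1)%R v))) => //.
  exact: ruleM.
move=> v; rewrite -[RHS](e v) /loop [in RHS]/rule /= [in RHS](gca_split cF b) rule_delta //.
by rewrite mulrS addrAC subrr add0r.
Qed.

Let fresh_multiple a b (S : seq G) : b != 0%R -> exists k, (a + b *+ k)%R \notin S.
Proof.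
move=> b0; apply: NNPP => H.
have inS k : (a + b *+ k)%R \in S.
  by apply/negPn/negP => nS; apply: H; exists k.
have inj : injective (fun k : nat => (a + b *+ k)%R).
  move=> k l /addrI e; apply/eqP; move: b0; apply: contraNT => kl.
  apply/eqP/matrixP => i j; have := congr1 (fun m : G => m i j) e.
  rewrite !mulmxnE mxE; case: (eqVneq (b i j) 0%R) => // bij /(Num.Theory.mulrIn bij).
  by move/eqP; rewrite (negPf kl).
have [i [j [/andP[lij _] /inj eij]]] := pigeonhole_seq inS.
by rewrite eij ltnn in lij.
Qed.

(** All iterates have coefficients supported in one finite set, while [a + b *+ k] leaves it for
    some [k]. The coefficient there vanishes, hence so does the part passing through [a] and then
    [k] times through [b]; [r_idem] collapses the repeated [r b]. *)
Let r_comp_eq0 a b v : b != 0%R -> r a (r b v) = 1%g.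
Proof.
move=> b0; have [S HS] := evper_supp cF eF.
have [k kS] := fresh_multiple a S b0.
have cFk := gca_iter k cF.
have e u : r a (loop b k u) = 1%g.
  apply: (@no_cancel id (loop b k) a (fun v => iter k F (delta (a + b *+ k)%R v))) => //.
    exact: ruleM.
  move=> w; rewrite -[RHS](HS k.+1 _ w kS) /loop [in RHS]/rule /= [in RHS](gca_split cF a) rule_delta //.
  by rewrite addrAC subrr add0r.
have loop0 w : loop b 0 w = w by rewrite /loop /rule /delta mulr0n /= eqxx.
case: k e {kS cFk} => [|k] e; first by rewrite -(loop0 (r b v)) e.
have {}e := loopS (ruleM cF a) e.
(* Each turn peels one [r b] off the loop and absorbs it into the [r b] already outside. *)
elim: k e => [|k IH] e; first by rewrite -(loop0 v) e.
apply: IH => u; rewrite -r_idem; apply: (loopS (psi := fun x => r a (r b x))) => // x y.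
by rewrite !ruleM.
Qed.

(** Both coefficients at [m] equal [r m (r 0%R v)], the other terms vanishing by [r_comp_eq0]: for
    [F \o F] split the outer [F] at [m], for [F] replace [v] by [rb v] and split at the origin. *)
Lemma perfect_idem : F \o F =1 F.
Proof.
apply: (gca_ext (gca_comp cF cF) cF) => m v; rewrite [in LHS]/rule /=.
rewrite [in LHS](gca_split cF m) rule_delta // subrr.
rewrite (_ : rest m _ = 1%g) ?mulg1; last first.
  apply: (gca_ind cF (P := fun y => y = 1%g)) => // [x y -> ->|a]; first by rewrite mulg1.
  rewrite /erase; case: eqVneq => [_|ne]; first by rewrite rule1.
  by rewrite rule_delta // r_comp_eq0 // subr_eq0 eq_sym.
rewrite -/(r m v) -[RHS](r_rb m v) /rb (gca_split cF 0%R) ruleM // -[LHS]mulg1.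
congr (_ * _)%g; symmetry; apply: (gca_ind cF (P := fun y => r m y = 1%g)).
- exact: rule1.
- by move=> y z ey ez; rewrite ruleM // ey ez mulg1.
- by move=> c; rewrite /erase; case: eqVneq => [_|ne]; rewrite ?rule1 // r_comp_eq0.
Qed.

End Perfect.

Lemma bounded_evper_perfect d (V : finGroupType) :
  ([set: V]^`(1) = [set: V])%g -> bounded_evper d V.
Proof.
move=> perf; have [n n0 idn] := gca_const_idem d V.
exists n => // F cF eF x.
rewrite iterD; apply: perfect_idem => //; first exact: gca_iter.
  exact: evper_iter.
by move=> v; rewrite -iterD; apply: idn.
Qed.

(** * Extensions *)

Section Transfer.

Variables (d : nat) (V W : finGroupType) (H : {group V}).
Variables (theta : V -> W) (j : W -> V) (F : configuration d V -> configuration d V).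
Hypotheses (thetaM : {in H &, {morph theta : v w / (v * w)%g}})
  (jH : forall w, j w \in H) (jK : cancel j theta).
Hypotheses (cF : gca F) (eF : evper F).
Hypothesis stabH : forall x, (forall g, x g \in H) -> forall g, F x g \in H.
Hypothesis stabK : forall x, (forall g, x g \in H /\ theta (x g) = 1%g) ->
  forall g, theta (F x g) = 1%g.

Lemma theta_iter n x : (forall g, x g \in H) -> forall g, iter n F x g \in H.
Proof. by move=> xH; elim: n => //= n IH g; apply: stabH. Qed.

Lemma theta_F x y : (forall g, x g \in H) -> (forall g, y g \in H) ->
  (forall g, theta (x g) = theta (y g)) -> forall g, theta (F x g) = theta (F y g).
Proof.
move=> xH yH exy g.
have -> : x = fun k => (y k * ((y k)^-1 * x k))%g.
  by apply: functional_extensionality => k; rewrite mulKVg.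
have zH k : ((y k)^-1 * x k)%g \in H by rewrite groupM ?groupV.
rewrite gcaM // thetaM ?stabH // [X in (_ * X)%g]stabK ?mulg1 // => k.
split; first exact: zH.
apply: (mulgI (theta (y k))).
by rewrite -thetaM // mulKVg mulg1 exy.
Qed.

(** The map [j] is a mere section: by [theta_F] the choice of lift does not matter. With [subg L]
    for [theta] this is restriction to a subgroup, with [coset L] passage to a quotient. *)
Definition pushforward (y : configuration d W) : configuration d W :=
  fun g => theta (F (fun k => j (y k)) g).

Lemma pushforwardE x : (forall g, x g \in H) ->
  pushforward (fun g => theta (x g)) = fun g => theta (F x g).
Proof.
move=> xH; apply: functional_extensionality => g.
by apply: theta_F => // k; rewrite jK.
Qed.

Lemma pushforward_iter n x : (forall g, x g \in H) ->
  iter n pushforward (fun g => theta (x g)) = fun g => theta (iter n F x g).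
Proof.
move=> xH; elim: n => //= n ->.
by rewrite pushforwardE //; exact: theta_iter.
Qed.

Lemma gca_pushforward : gca pushforward.
Proof.
split=> [x y g|x h g|].
- rewrite /pushforward -thetaM ?stabH //.
  rewrite [X in _ = theta X](_ : _ = F (fun k => j (x k) * j (y k))%g g); last by rewrite gcaM.
  apply: theta_F => k //.
    by rewrite groupM.
  by rewrite thetaM // !jK.
- by rewrite /pushforward -gca_shift.
have [_ _ [S FL]] := cF; exists S => x y exy.
by rewrite /pushforward; congr theta; apply: FL => a Sa; rewrite exy.
Qed.

Lemma evper_pushforward : evper pushforward.
Proof.
case: eF => m [n [n0 e]]; exists m, n; split=> // y.
have -> : y = fun g => theta (j (y g)).
  by apply: functional_extensionality => g; rewrite jK.
by rewrite !pushforward_iter // e.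
Qed.

Lemma bounded_evper_transfer n :
  (forall F' : configuration d W -> configuration d W,
     gca F' -> evper F' -> iter (n + n) F' =1 iter n F') ->
  forall x, (forall g, x g \in H) ->
  forall g, theta (iter (n + n) F x g) = theta (iter n F x g).
Proof.
move=> bn x xH g.
have := bn _ gca_pushforward evper_pushforward (fun g => theta (x g)).
by rewrite !pushforward_iter // => /(congr1 (@^~ g)).
Qed.

End Transfer.

Lemma gca_stable d (V : finGroupType) (F : configuration d V -> configuration d V)
    (L : {group V}) :
  gca F -> (forall f : V -> V, {morph f : v w / (v * w)%g} ->
    forall v, v \in L -> f v \in L) ->
  forall x, (forall g, x g \in L) -> forall g, F x g \in L.
Proof.
move=> cF fL x xL g; rewrite -[g]add0r -(gca_shift cF).
apply: (gca_ind cF (P := fun y => y \in L)) => [//|v w|a]; first exact: groupM.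
by apply: fL => //; exact: ruleM.
Qed.

Lemma bounded_evper_iso d (V W : finGroupType) (theta : V -> W) (j : W -> V) :
  {morph theta : v w / (v * w)%g} -> cancel theta j -> cancel j theta ->
  bounded_evper d W -> bounded_evper d V.
Proof.
move=> thetaM thK jK [n n0 bW]; exists n => // F cF eF x.
apply: functional_extensionality => g; apply: (can_inj thK).
apply: (bounded_evper_transfer (H := [set: V]) (j := j)) => //.
- by move=> w; rewrite in_setT.
- by move=> y _ k; rewrite in_setT.
have t1 : theta 1%g = 1%g by apply: (mulgI (theta 1%g)); rewrite -thetaM !mulg1.
move=> y ky k; rewrite (_ : y = fun=> 1%g) ?gca1 //.
apply: functional_extensionality => l; apply: (can_inj thK).
by rewrite (ky l).2.
Qed.

(** Let [p] be the [N]-th iterate of [F], idempotent on [L]-valued configurations and modulo [L].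
    Then [p (p x)] is [p x] times an [L]-valued [w], and from the third iterate on each application
    of [p] multiplies by the same [p w]. After [#|V|] further steps the accumulated power of [p w]
    is trivial. *)
Lemma bounded_evper_ext d (V : finGroupType) (L : {group V}) : (L <| [set: V])%g ->
  (forall f : V -> V, {morph f : v w / (v * w)%g} ->
    forall v, v \in L -> f v \in L) ->
  bounded_evper d (subg_of L) -> bounded_evper d (coset_of L) -> bounded_evper d V.
Proof.
move=> nL fL [n n0 bL] [m m0 bQ].
set e := #|V|; set N := m * n.
have N0 : 0 < N by rewrite muln_gt0 m0.
(* The iterates of [F] of orders [3 * N] and [(3 + e) * N] will coincide. *)
exists ((3 + e) * N)`!; first exact: fact_gt0.
move=> F cF eF.
have stab := gca_stable cF fL.
have [_ nL'] := andP nL.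
have normL v : v \in 'N(L)%g by apply: (subsetP nL'); rewrite in_setT.
pose p := iter N F.
have cp : gca p by exact: gca_iter.
have pk k x : iter k p x = iter (k * N) F x by rewrite iterM.
have idL x : (forall g, x g \in L) -> p (p x) = p x.
  move=> xL; apply: functional_extensionality => g.
  have iL k h : iter k F x h \in L by exact: (theta_iter stab).
  rewrite /p -iterD.
  suff : subg L (iter (N + N) F x g) = subg L (iter N F x g).
    by move/(congr1 (@sgval _ L)); rewrite !subgK ?iL // => ->.
  apply: (bounded_evper_transfer (H := L) (theta := subg L) (j := @sgval _ L)) => //.
  - by move=> v w vL wL; apply: val_inj; rewrite /= !subgK ?groupM.
  - exact: subgP.
  - exact: sgvalK.
  - move=> y yL h; rewrite (_ : y = fun=> 1%g).
      by rewrite gca1 //; apply: val_inj; rewrite /= subgK.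
    apply: functional_extensionality => l.
    by have [yl /(congr1 (@sgval _ L))] := yL l; rewrite subgK.
  by move=> F' cF' eF'; rewrite /N; apply: iter_idem_mul => //; exact: bL.
have idQ x g : coset L (p (p x) g) = coset L (p x g).
  rewrite /p -iterD.
  apply: (bounded_evper_transfer (H := [set: V]) (j := @repr _ : coset_of L -> V)) => //.
  - by move=> v w _ _; rewrite coset_morphM.
  - by move=> w; rewrite in_setT.
  - exact: coset_reprK.
  - by move=> y _ k; rewrite in_setT.
  - move=> y yL h; apply: coset_id; apply: stab => k.
    by apply: coset_idr; [exact: normL | exact: (yL k).2].
  by move=> F' cF' eF'; rewrite /N mulnC; apply: iter_idem_mul => //; exact: bQ.
apply: (@iter_idem_fact _ _ (3 * N) ((3 + e) * N)).
  rewrite leqnn andbT ltn_mul2r N0 /= -[3 in X in X < _]addn0 ltn_add2l.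
  by apply/card_gt0P; exists 1%g.
move=> x; rewrite -!pk.
pose w g := ((p x g)^-1 * p (p x) g)%g.
have wL g : w g \in L.
  apply: coset_idr; first exact: normL.
  by apply: (mulgI (coset L (p x g))); rewrite -coset_morphM // mulKVg idQ mulg1.
have ppx : p (p x) = fun g => (p x g * w g)%g.
  by apply: functional_extensionality => g; rewrite mulKVg.
have step k : iter (3 + k) p x = fun g => (iter 3 p x g * p w g ^+ k)%g.
  elim: k => [|k IH]; first by apply: functional_extensionality => g; rewrite mulg1.
  rewrite addnS iterS IH; clear IH.
  have E : p (p (p x)) = fun g => (p (p x) g * p w g)%g by rewrite {1}ppx (gcaM cp).
  have E' : p (p (p (p x))) = fun g => (p (p (p x)) g * p w g)%g.
    by rewrite {1}E (gcaM cp) (idL w wL).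
  have px : p (fun g => p w g ^+ k)%g = (fun g => p w g ^+ k)%g.
    elim: k => [|k IH]; first exact: (gca1 cp).
    rewrite (_ : (fun g => _) = fun g => (p w g * p w g ^+ k)%g).
      by rewrite (gcaM cp) (idL w wL) IH.
    by apply: functional_extensionality => g; rewrite expgS.
  rewrite (gcaM cp) px /= E'; apply: functional_extensionality => g.
  by rewrite expgS mulgA.
rewrite (step e); apply: functional_extensionality => g.
have pe : (p w g ^+ e)%g = 1%g by rewrite /e -cardsT (expg_cardG (in_setT _)).
by rewrite pe mulg1.
Qed.

(** * Elementary abelian groups *)

(** The field is that of rational functions in [d] variables, and [mon] sends an exponent vector to
    its Laurent monomial. The last clause is linear independence of monomials. *)
Lemma laurent_field (d : nat) (k : fieldType) :
  exists (K : fieldType) (emb : {rmorphism k -> K}) (mon : 'rV[int]_d -> K),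
    [/\ mon 0%R = 1%R, {morph mon : a b / (a + b)%R >-> (a * b)%R}
      & forall (S : seq 'rV[int]_d) (c : 'rV[int]_d -> k), uniq S ->
        (\sum_(a <- S) mon a * emb (c a) = 0)%R -> {in S, forall a, c a = 0%R}].
Proof.
pose K : fieldType := {fraction {mpoly k[d]}}.
pose emb : {rmorphism k -> K} := @tofrac _ \o @mpolyC d k.
pose mon (a : 'rV[int]_d) : K :=
  (\prod_(i < d) (@tofrac {mpoly k[d]} 'X_i : K) ^ a 0 i)%R.
have X0 i : tofrac ('X_i : {mpoly k[d]}) != 0%R.
  rewrite tofrac_eq0; apply/eqP => /(congr1 (mcoeff U_(i)%MM)).
  by rewrite mcoeffX eqxx mcoeff0 => /eqP; rewrite oner_eq0.
have monD : {morph mon : a b / (a + b)%R >-> (a * b)%R}.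
  move=> a b; rewrite /mon -big_split; apply: eq_bigr => i _.
  by rewrite mxE expfzDr.
exists K, emb, mon; split=> // [|S c uS S0 a0 aS].
  by rewrite /mon big1 // => i _; rewrite mxE expr0z.
(* Multiplication by the monomial with all exponents [B] turns the relation into one between
   ordinary monomials. *)
have [B HB] : exists B : nat, forall a, a \in S -> forall i, (0 <= (B%:Z + a 0 i)%R)%R.
  elim: (S) => [|a T [B HB]]; first by exists 0.
  exists (B + \sum_i `|a 0%R i|)%N => b; rewrite inE => /orP[/eqP->|bT] i.
    by rewrite (bigD1 i) //=; lia.
  have := HB b bT i; lia.
pose ex (a : 'rV[int]_d) : 'X_{1..d} := [multinom `|(B%:Z + a 0%R i)%R|%N | i < d].
have monX a : a \in S -> (mon (const_mx B%:Z) * mon a)%R = tofrac 'X_[ex a].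
  move=> Sa; rewrite -monD mpolyXE_id rmorph_prod /mon; apply: eq_bigr => i _.
  rewrite rmorphXn mnmE !mxE -[X in (_ ^ X)%R]gez0_abs ?HB //.
have S0' : (\sum_(a <- S) c a *: 'X_[ex a] = 0 :> {mpoly k[d]})%R.
  apply/eqP; rewrite -tofrac_eq0; apply/eqP.
  rewrite -[RHS](mulr0 (mon (const_mx B%:Z)%R)) -S0 rmorph_sum mulr_sumr.
  apply: eq_big_seq => a Sa; rewrite mulrA monX //= -mul_mpolyC rmorphM /=.
  by rewrite mulrC.
have := congr1 (mcoeff (ex a0)) S0'; rewrite mcoeff0 raddf_sum /=.
rewrite (bigD1_seq a0) //= mcoeffZ mcoeffX eqxx mulr1 big_seq_cond big1 ?addr0 //.
move=> a /andP[Sa ne]; rewrite mcoeffZ mcoeffX.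
case: eqP => [e|]; last by rewrite mulr0.
case/eqP: ne; apply/matrixP => i j; rewrite ord1.
move: e => /mnmP/(_ j); rewrite !mnmE => e.
by move: e => /(congr1 Posz); rewrite !gez0_abs ?HB // => /addrI.
Qed.

Lemma big_uniq_ext (R : nmodType) (I : eqType) (S T : seq I) (f : I -> R) :
  uniq S -> uniq T -> {subset S <= T} -> (forall a, a \notin S -> f a = 0%R) ->
  (\sum_(a <- T) f a = \sum_(a <- S) f a)%R.
Proof.
move=> uS uT sST f0; rewrite (bigID (mem S)) /= [X in (_ + X)%R]big1 ?addr0 //.
rewrite -big_filter; apply: perm_big; apply: uniq_perm; rewrite ?filter_uniq //.
by move=> a; rewrite mem_filter; apply/andP/idP => [[]//|aS]; split=> //; exact: sST.
Qed.

(** * Matrix symbols over a field containing the Laurent polynomials *)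

Section Symbol.

Variables (d p n : nat).
Local Notation G := 'rV[int]_d.
Local Notation V := ('rV['F_p]_n).
Local Notation conf := (configuration d V).
Implicit Types (F H : conf -> conf).

Variables (K : fieldType) (emb : {rmorphism 'F_p -> K}) (mon : G -> K).
Hypotheses (mon0 : mon 0%R = 1%R) (monD : {morph mon : a b / (a + b)%R >-> (a * b)%R}).
Hypothesis mon_free : forall (S : seq G) (c : G -> 'F_p), uniq S ->
  (\sum_(a <- S) mon a * emb (c a) = 0)%R -> {in S, forall a, c a = 0%R}.

Definition rule_mx F a : 'M['F_p]_n := (\matrix_i rule F a (delta_mx 0 i))%R.

(** Additivity gives linearity, because every scalar of ['F_p] is a natural multiple of 1. *)
Lemma ruleE F a v : gca F -> rule F a v = (v *m rule_mx F a)%R.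
Proof.
move=> cF; pose f := rule F a.
have f0 : f 0%R = 0%R := rule1 cF a.
have fD : {morph f : v w / (v + w)%R} := ruleM cF a.
have fMn w k : f (w *+ k)%R = (f w *+ k)%R.
  by elim: k => [|k IH]; rewrite ?mulr0n // !mulrS fD IH.
rewrite mulmx_sum_row -/f {1}[v]row_sum_delta (big_morph f fD f0).
apply: eq_bigr => i _; rewrite rowK -/f.
by rewrite -[v 0%R i]natr_Zp !scaler_nat fMn.
Qed.

(** The matrix of [F] over the Laurent polynomials; a relation, because the support list is only
    known to exist. *)
Definition symbol (A : 'M[K]_n) F : Prop :=
  gca F /\ exists S : seq G, [/\ uniq S, forall a, a \notin S -> rule_mx F a = 0%R
    & A = (\sum_(a <- S) mon a *: map_mx emb (rule_mx F a))%R].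

Lemma symbol_exists F : gca F -> exists A, symbol A F.
Proof.
move=> cF; have [_ _ [S FL]] := cF.
exists (\sum_(a <- undup S) mon a *: map_mx emb (rule_mx F a))%R.
split=> //; exists (undup S); rewrite undup_uniq; split=> // a; rewrite mem_undup => aS.
apply/row_matrixP => i; rewrite rowK row0 /rule.
rewrite (FL _ (fun=> 1%g)) ?gca1 // => b bS.
by rewrite delta_out //; apply: contraNneq aS => <-.
Qed.

(** Independence of the monomials recovers every coefficient from the symbol, so that matrix
    identities become identities of automata. *)
Lemma symbol_inj A F H : symbol A F -> symbol A H -> F =1 H.
Proof.
move=> [cF [S [uS FS ->]]] [cH [T [uT HT eA]]]; apply: gca_ext => // a v.
rewrite !ruleE //; congr (_ *m _)%R.
pose U := undup (S ++ T).
have uU : uniq U by exact: undup_uniq.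
have SU b : b \in S -> b \in U by rewrite mem_undup mem_cat => ->.
have TU b : b \in T -> b \in U by rewrite mem_undup mem_cat orbC => ->.
rewrite -(@big_uniq_ext _ _ S U) // in eA; last first.
  by move=> b bS; rewrite FS // map_mx0 scaler0.
rewrite -(@big_uniq_ext _ _ T U) // in eA; last first.
  by move=> b bS; rewrite HT // map_mx0 scaler0.
have [aU|aU] := boolP (a \in U); last first.
  by rewrite FS ?HT //; apply: contra aU; [exact: TU | exact: SU].
apply/matrixP => i j; apply/eqP; rewrite -subr_eq0; apply/eqP.
apply: (mon_free (c := fun b => (rule_mx F b i j - rule_mx H b i j)%R) uU _ aU).
have := congr1 (fun B : 'M_n => B i j) eA => /=; rewrite !summxE => /eqP.
rewrite -subr_eq0 -sumrB => /eqP e; rewrite -[RHS]e; apply: eq_bigr => b _.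
by rewrite !mxE rmorphB mulrBr.
Qed.

Lemma symbol_uniq A B F H : symbol A F -> symbol B H -> F =1 H -> A = B.
Proof.
move=> [cF [S [uS FS ->]]] [cH [T [uT HT ->]]] eFH.
have eM : rule_mx F =1 rule_mx H by move=> a; apply/row_matrixP => i; rewrite !rowK /rule eFH.
rewrite -(@big_uniq_ext _ _ S (undup (S ++ T))) ?undup_uniq //; first last.
- by move=> b bS; rewrite FS // map_mx0 scaler0.
- by move=> b bS; rewrite mem_undup mem_cat bS.
rewrite -(@big_uniq_ext _ _ T (undup (S ++ T))) ?undup_uniq //; first last.
- by move=> b bS; rewrite HT // map_mx0 scaler0.
- by move=> b bS; rewrite mem_undup mem_cat bS orbT.
by apply: eq_bigr => b _; rewrite eM.
Qed.

Lemma monMn h m : mon (h *+ m)%R = (mon h ^+ m)%R.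
Proof. by elim: m => [|m IH]; rewrite ?mulr0n ?mon0 // mulrS monD IH exprS. Qed.

Lemma symbol_id : symbol 1%:M id.
Proof.
split; first exact: gca_id.
exists [:: 0%R]; split=> // [a|].
  rewrite inE => a0; apply/row_matrixP => i; rewrite rowK row0 /rule.
  by rewrite delta_out // eq_sym.
rewrite big_seq1 mon0 scale1r (_ : rule_mx id 0%R = 1%:M%R) ?map_mx1 //.
by apply/row_matrixP => i; rewrite rowK row1 /rule /delta eqxx.
Qed.

(** Coefficients of a composite are convolutions. The order of the matrices is reversed because they
    act on row vectors from the right. *)
Lemma symbol_comp A B F H : symbol A F -> symbol B H -> symbol (B *m A)%R (F \o H).
Proof.
move=> [cF [S [uS FS ->]]] [cH [T [uT HT ->]]].
have cFH := gca_comp cF cH; split=> //.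
have comp_mx m : rule_mx (F \o H) m = (\sum_(a <- S) rule_mx H (m - a) *m rule_mx F a)%R.
  apply/row_matrixP => i; rewrite rowK /rule /=.
  have [S' uS' /(_ (undup (S ++ S')) (undup_uniq _)) FS'] := gca_supp cF.
  rewrite FS'; last by move=> b bS; rewrite mem_undup mem_cat bS orbT.
  rewrite -[LHS]/(\sum_(a <- undup (S ++ S')) _)%R.
  rewrite (@big_uniq_ext _ _ S) ?undup_uniq //; first last.
  - by move=> b bS; rewrite ruleE // FS // mulmx0.
  - by move=> b bS; rewrite mem_undup mem_cat bS.
  rewrite linear_sum /=; apply: eq_bigr => a _.
  by rewrite ruleE // rule_delta // row_mul rowK.
pose U := undup [seq (a + b)%R | a <- S, b <- T].
have inU a b : a \in S -> b \in T -> (a + b)%R \in U.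
  by move=> aS bT; rewrite mem_undup allpairs_f.
exists U; rewrite undup_uniq; split=> // [m mU|].
  rewrite comp_mx big_seq big1 // => a aS; rewrite HT ?mul0mx //.
  by apply: contra mU => maT; rewrite -[m](subrKC a) inU.
rewrite mulmx_sumr.
under [RHS]eq_bigr do rewrite comp_mx raddf_sum /= scaler_sumr.
rewrite exchange_big /=; apply: eq_big_seq => a aS.
rewrite (@big_uniq_ext _ _ [seq (a + b)%R | b <- T] U) ?undup_uniq //; first last.
- move=> m mT; rewrite HT ?mul0mx ?map_mx0 ?scaler0 //.
  by apply: contra mT => maT; rewrite -[m](subrKC a); apply: map_f.
- by move=> _ /mapP[b bT ->]; exact: inU.
- by rewrite map_inj_uniq //; exact: addrI.
rewrite big_map mulmx_suml; apply: eq_bigr => b _.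
by rewrite addrAC subrr add0r monD map_mxM -scalemxAl -scalemxAr scalerA mulrC.
Qed.

Lemma gca_sub F H : gca F -> gca H -> gca (fun x g => (F x g - H x g)%R).
Proof.
move=> cF cH; split=> [x y g|x h g|].
- rewrite (gcaM cF) (gcaM cH).
  by rewrite -[LHS]/(F x g + F y g - (H x g + H y g))%R opprD addrACA.
- by rewrite !gca_shift.
have [_ _ [S FL]] := cF; have [_ _ [T HL]] := cH.
exists (S ++ T) => x y exy; rewrite (FL _ y) 1?(HL _ y) // => a aS; apply: exy;
  by rewrite mem_cat aS ?orbT.
Qed.

Lemma symbol_sub A B F H : symbol A F -> symbol B H ->
  symbol (A - B)%R (fun x g => (F x g - H x g)%R).
Proof.
move=> [cF [S [uS FS ->]]] [cH [T [uT HT ->]]].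
have cFH := gca_sub cF cH; split=> //.
have sub_mx a : rule_mx (fun x g => (F x g - H x g)%R) a = (rule_mx F a - rule_mx H a)%R.
  by apply/row_matrixP => i; rewrite linearB /= !rowK.
exists (undup (S ++ T)); rewrite undup_uniq; split=> // [a|].
  by rewrite mem_undup mem_cat negb_or sub_mx => /andP[aS aT]; rewrite FS // HT // subr0.
rewrite -(@big_uniq_ext _ _ S (undup (S ++ T))) ?undup_uniq //; first last.
- by move=> b bS; rewrite FS // map_mx0 scaler0.
- by move=> b bS; rewrite mem_undup mem_cat bS.
rewrite -(@big_uniq_ext _ _ T (undup (S ++ T))) ?undup_uniq //; first last.
- by move=> b bS; rewrite HT // map_mx0 scaler0.
- by move=> b bS; rewrite mem_undup mem_cat bS orbT.
by rewrite -sumrB; apply: eq_bigr => b _; rewrite sub_mx map_mxB scalerBr.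
Qed.

Lemma gca_shift_by h : gca (fun (x : conf) g => x (g + h)%R).
Proof.
split=> // [x k g|]; first by rewrite addrAC.
by exists [:: h] => x y exy; rewrite add0r exy ?inE.
Qed.

Lemma symbol_shift h : symbol (mon h)%:M%R (fun (x : conf) g => x (g + h)%R).
Proof.
split; first exact: gca_shift_by.
exists [:: h]; split=> // [a|].
  rewrite inE => ah; apply/row_matrixP => i; rewrite rowK row0 /rule add0r.
  by rewrite delta_out // eq_sym.
rewrite big_seq1 (_ : rule_mx _ h = 1%:M%R) ?map_mx1 ?scalemx1 //.
by apply/row_matrixP => i; rewrite rowK row1 /rule /delta add0r eqxx.
Qed.

Lemma symbol_iter_scalar c F k : symbol c%:M%R F -> symbol (c ^+ k)%:M%R (iter k F).
Proof.
move=> rF; elim: k => [|k IH]; first exact: symbol_id.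
have := symbol_comp rF IH; rewrite -scalar_mxM exprSr.
by case: (IH) => _ _ []; split.
Qed.

Definition diff h (x : conf) : conf := fun g => (x (g + h) - x g)%R.

(** The symbol of [diff h] is the scalar [mon h - 1], to which the Frobenius applies in
    characteristic [p]. *)
Lemma diff_iter_pexp h k x : prime p ->
  iter (p ^ k) (diff h) x = fun g => (x (g + h *+ (p ^ k)) - x g)%R.
Proof.
move=> p_pr.
have rd g : symbol (mon g - 1)%:M%R (diff g).
  by have := symbol_sub (symbol_shift g) symbol_id; rewrite -raddfB.
have pcharK : p \in [pchar K]%R by rewrite (rmorph_pchar emb) ?pchar_Fp.
have e : ((mon h - 1) ^+ (p ^ k) = mon (h *+ (p ^ k)) - 1)%R.
  elim: k => [|k IH]; first by rewrite expn0 expr1 mulr1n.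
  rewrite expnSr exprM IH -(pFrobenius_autE pcharK).
  rewrite pFrobenius_autB_comm ?pFrobenius_aut1; last exact: commr1.
  by rewrite pFrobenius_autE -monMn mulrnA.
have := symbol_iter_scalar (p ^ k) (rd h); rewrite e => r1.
exact: (symbol_inj r1 (rd _) x).
Qed.

(* A p-group acting on a nonzero p-group has a nonzero fixed point; here the
   lattice acts by shifts on the periodic configurations in the image of E. *)
Lemma idem_const0 (E : conf -> conf) : prime p -> gca E -> E \o E =1 E ->
  (forall v, E (fun=> v) = fun=> 0%R) -> forall x, E x = fun=> 0%R.
Proof.
move=> p_pr cE EE Ec x; apply: NNPP => Ex0.
have {Ex0} [z Ez0] : exists z : conf, E z 0%R != 0%R.
  apply: NNPP => H; apply: Ex0; apply: functional_extensionality => g.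
  apply/eqP/negPn/negP => nz; apply: H; exists (fun k => x (k + g)%R).
  by rewrite gca_shift // add0r.
pose e i : G := delta_mx 0%R i.
have [_ _ [S SE]] := cE.
have [B HB] : exists B : nat, forall a, a \in S -> forall i, (`|a 0%R i|)%N <= B.
  elim: (S) => [|a T [B HB]]; first by exists 0.
  exists (B + \sum_i `|a 0%R i|)%N => b; rewrite inE => /orP[/eqP->|bT] i.
    by rewrite (bigD1 i) //=; lia.
  have := HB b bT i; lia.
(* A period larger than [B.*2] lets the memory window, with coordinates between [-B] and [B], embed
   in one fundamental domain. *)
have [k Bk] : exists k, B.*2 < p ^ k.
  by exists B.*2; apply: ltn_expl; exact: prime_gt1.
set q := p ^ k in Bk.
have q0 : 0 < q by rewrite expn_gt0 prime_gt0.
pose red (g : G) : G := (\row_i (modz (g 0 i + B%:Z) q%:Z - B%:Z))%R.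
pose inv (y : conf) h := forall g, y (g + h)%R = y g.
(* Periodise [z] along [red], which is the identity on the memory set, and apply [E]: the value at
   the origin stays nonzero. *)
have [y0 [y0E y0q y0n]] : exists y, [/\ E y = y, forall i, inv y (e i *+ q)%R & exists g,
  y g != 0%R].
  exists (E (fun g => z (red g))); split.
  - by rewrite -[LHS]/((E \o E) _) EE.
  - move=> i g; rewrite -gca_shift //; congr (E _ g).
    apply: functional_extensionality => h; congr z; apply/matrixP => j l.
    rewrite !mxE mulmxnE !mxE; congr (_ - _)%R.
    case: (_ && _); last by rewrite mul0rn addr0.
    by rewrite addrAC /= mulr1n natz modzDr.
  exists 0%R; rewrite (SE _ z) // => a aS; congr z.
  apply/matrixP => j l; rewrite mxE ord1 modz_small ?addrK //.
  by move: (a 0%R l : int) (HB a aS l) Bk; clear; move=> t; lia.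
(* Invariance is gained for one basis vector at a time. *)
have step m : m <= d -> exists y, [/\ E y = y, forall i, inv y (e i *+ q)%R,
    exists g, y g != 0%R & forall i : 'I_d, i < m -> inv y (e i)].
  elim: m => [_|m IH ltm]; first by exists y0; split.
  have [y [yE yq [g yn] ym]] := IH (ltnW ltm).
  pose i := Ordinal ltm;
  have inv_diff u h : inv u h -> inv (diff (e i) u) h.
    by move=> ui l; rewrite /diff addrAC !ui.
  have DE l : E (iter l (diff (e i)) y) = iter l (diff (e i)) y.
    elim: l => //= l {2}<-; rewrite /diff; set u := iter l _ y.
    apply: functional_extensionality => h.
    have EN : E (fun g => - u g)%R h = (- E u h)%R.
      apply/eqP; rewrite -addr_eq0; apply/eqP.
      apply: etrans (esym (congr1 (@^~ h) (gcaM cE (fun g => - u g)%R u))) _.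
      apply: etrans _ (congr1 (@^~ h) (gca1 cE)); congr (E _ h).
      by apply: functional_extensionality => c; exact: addNr.
    apply: etrans (congr1 (@^~ h) (gcaM cE (fun g => u (g + e i)%R) (fun g => - u g)%R)) _.
    by rewrite /= EN gca_shift.
  have Dq : iter q (diff (e i)) y = fun=> 0%R.
    rewrite diff_iter_pexp //; apply: functional_extensionality => l.
    by rewrite yq subrr.
  (* Take the last nonzero iterate of [diff (e i)]: being killed by one more application, it is
     invariant under [e i], and the earlier invariances persist. *)
  have [l [Dl0 Dl1]] : exists l, (exists g, iter l (diff (e i)) y g != 0%R) /\
      iter l.+1 (diff (e i)) y = fun=> 0%R.
    elim: (q) Dq => [y00|l IHl Dl1]; first by case/eqP: yn; exact: (congr1 (@^~ g) y00).
    case: (classic (exists g, iter l (diff (e i)) y g != 0%R)) => [Dn|Dn].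
      by exists l.
    apply: IHl; apply: functional_extensionality => h.
    by apply/eqP/negPn/negP => nz; apply: Dn; exists h.
  exists (iter l (diff (e i)) y); split=> //.
  - by move=> j; elim: (l) => [|l' IHl]; [exact: yq | exact: inv_diff].
  move=> j; rewrite ltnS leq_eqVlt => /orP[/eqP ji|jm].
    move=> h; have -> : j = i by exact: val_inj.
    have := congr1 (@^~ h) Dl1; rewrite /= /diff => /eqP.
    by rewrite subr_eq0 => /eqP.
  by elim: (l) => [|l' IHl]; [exact: ym | exact: inv_diff].
have [y [yE _ [g yn] yinv]] := step d (leqnn d).
have yc h : inv y h.
  rewrite [h]row_sum_delta; elim/big_rec: _ => [l|i w _ IH l]; first by rewrite addr0.
  rewrite addrA IH -/(e i); clear - yinv.
  have invn m : inv y (e i *+ m)%R.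
    elim: m => [|m IH] a; first by rewrite mulr0n addr0.
    by rewrite mulrS addrA IH yinv.
  rewrite -[h 0%R i]intz scaler_int; case: (h 0%R i) => m.
    by rewrite -pmulrn invn.
  by rewrite NegzE mulrNz -pmulrn -[in RHS](subrK (e i *+ m.+1)%R l) invn.
have yE0 : y = fun=> y 0%R.
  by apply: functional_extensionality => h; rewrite -{1}[h]add0r yc.
by move: yn; rewrite -yE yE0 Ec eqxx.
Qed.

End Symbol.

(** The minimal polynomial divides a power of X, so it is associate to a power of X; it also divides
    the characteristic polynomial, of degree [n.+1]. *)
Lemma nilpotent_mx (K : fieldType) (n m : nat) (B : 'M[K]_n.+1) :
  (B ^+ m = 0 -> B ^+ n.+1 = 0)%R.
Proof.
move=> Bm.
have XnE k : (horner_mx B (('X - 0%:P) ^+ k) = B ^+ k)%R.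
  by rewrite subr0 rmorphXn /= horner_mx_X.
have /dvdp_exp_XsubCP[k _ eqk] : (mxminpoly B %| ('X - 0%:P) ^+ m)%R.
  by apply: mxminpoly_min; rewrite XnE.
have lekn : k <= n.+1.
  have := dvdp_leq (monic_neq0 (char_poly_monic B)) (mxminpoly_dvd_char B).
  by rewrite (eqp_size eqk) size_exp_XsubC size_char_poly.
rewrite -XnE; apply/eqP; rewrite -dvd_mxminpoly (eqp_dvdl _ eqk).
exact: dvdp_exp2l.
Qed.

Lemma bounded_evper_rV (d p n : nat) : prime p -> bounded_evper d ('rV['F_p]_n).
Proof.
move=> p_pr; case: n => [|n].
  exists 1 => // F _ _ x; apply: functional_extensionality => g.
  by apply/matrixP => i [].
have [K [emb [mon [mon0 monD mon_free]]]] := laurent_field d [the fieldType of 'F_p].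
have [N N0 idN] := gca_const_idem d ('rV['F_p]_n.+1).
(* The factor [p ^ n.+1] is a power of [p], for the Frobenius, and at least [n.+1], the exponent
   that kills nilpotent matrices of this size. *)
exists (p ^ n.+1 * N); first by rewrite muln_gt0 expn_gt0 prime_gt0.
move=> F cF [m [k [k0 e]]].
pose rp := @symbol d p n.+1 K emb mon.
have [A rA] : exists A, rp A F := symbol_exists emb mon cF.
have rX B H j : rp B H -> rp (B ^+ j)%R (iter j H).
  move=> rB; elim: j => [|j IH]; first exact: symbol_id.
  by have := symbol_comp monD rB IH; rewrite exprSr.
pose D x g := (iter (N + N) F x g - iter N F x g)%R.
pose B := (A ^+ (N + N) - A ^+ N)%R.
have rB : rp B D by apply: symbol_sub; apply: rX.
have pcharM : p \in [pchar 'M[K]_n.+1]%R.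
  have pK : p \in [pchar K]%R by rewrite (rmorph_pchar emb) ?pchar_Fp.
  by apply: (rmorph_pchar (@scalar_mx K n.+1)).
have BX s : (B ^+ (p ^ s) = A ^+ (p ^ s * (N + N)) - A ^+ (p ^ s * N))%R.
  elim: s => [|s IH]; first by rewrite expn0 !mul1n.
  rewrite expnSr exprM IH -(pFrobenius_autE pcharM) pFrobenius_autB_comm; last first.
    by apply: commrX; apply: commr_sym; apply: commrX.
  by rewrite !pFrobenius_autE -!exprM -!mulnA ![(p * _)%N]mulnC !mulnA.
have Asmall j : exists2 i, i < k + m & (A ^+ j = A ^+ i)%R.
  have [i lti ei] := iter_small k0 e j; exists i => //.
  exact: symbol_uniq (rX _ _ j rA) (rX _ _ i rA) ei.
(* [A] has finitely many distinct powers, so the differences given by [BX] take finitely many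
   values. *)
have [s [t [/andP[ltst _] eB]]] : exists s t, s < t <= size
    [seq (A ^+ i - A ^+ j)%R | i <- iota 0 (k + m), j <- iota 0 (k + m)] /\
    (B ^+ (p ^ s) = B ^+ (p ^ t))%R.
  apply: (pigeonhole_seq (f := fun s => B ^+ (p ^ s))%R) => s; rewrite BX.
  have [i lti ->] := Asmall (p ^ s * (N + N)); have [j ltj ->] := Asmall (p ^ s * N).
  by apply: allpairs_f; rewrite mem_iota.
pose M := (p ^ t)`!.
have BM : (B ^+ (M + M) = B ^+ M)%R.
  have lt : p ^ s < p ^ t <= p ^ t by rewrite leqnn andbT ltn_exp2l ?prime_gt1.
  have := @iter_idem_fact _ ( *%R B) _ _ _ lt.
  have iB j x : (iter j ( *%R B) x = B ^+ j * x)%R by rewrite iter_mulr.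
  move=> /(_ _ 1%R); rewrite !iB !mulr1; apply => x.
  by rewrite !iB eB.
have rE := rX _ _ M rB.
(* [iter M D] is idempotent by [BM], and it kills constants because [D] does and [M] is positive. *)
have E0 : forall x, iter M D x = fun=> 0%R.
  apply: (idem_const0 mon0 monD mon_free p_pr).
  - by case: rE.
  - have r2 := rX _ _ (M + M) rB; rewrite BM in r2.
    by move=> x; rewrite /= -iterD; apply: (symbol_inj mon_free r2 rE).
  move=> v; have -> : M = M.-1.+1 by rewrite prednK ?fact_gt0.
  rewrite iterSr (_ : D _ = fun=> 0%R); last first.
    by apply: functional_extensionality => g; rewrite /D idN // subrr.
  have [c _] := rX _ _ M.-1 rB; exact: (gca1 c).
have B0 : (B ^+ M = 0)%R.
  (* The zero automaton is presented as the difference of two identities, so its symbol is 0. *)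
  have r0 := symbol_sub (symbol_id n.+1 emb mon0) (symbol_id n.+1 emb mon0).
  rewrite subrr in r0; apply: symbol_uniq rE r0 _ => x.
  by rewrite E0; apply: functional_extensionality => g; rewrite subrr.
have : (B ^+ (p ^ n.+1) = 0)%R.
  rewrite -(subnKC (ltnW (ltn_expl n.+1 (prime_gt1 p_pr)))) exprD (nilpotent_mx B0).
  by rewrite mul0r.
rewrite BX -mulnDr => /eqP; rewrite subr_eq0 => /eqP eA.
have r1 := rX _ _ (p ^ n.+1 * (N + N)) rA; rewrite eA in r1.
by apply: (symbol_inj mon_free r1 (rX _ _ _ rA)).
Qed.

(** * Arbitrary finite groups *)

Lemma bounded_evper_abelem d (V : finGroupType) p :
  (p.-abelem [set: V])%g -> [set: V]%g != 1%g -> bounded_evper d V.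
Proof.
move=> abV ntV; have [p_pr _ _] := pgroup_pdiv (abelem_pgroup abV) ntV.
apply: (@bounded_evper_iso d V 'rV['F_p]_(abelem_dim' [set:
  V]).+1 (abelem_rV abV ntV) (rVabelem abV ntV)).
- by move=> v w; rewrite abelem_rV_M ?in_setT.
- by move=> v; rewrite abelem_rV_K ?in_setT.
- exact: rVabelemK.
exact: bounded_evper_rV.
Qed.

(** Induction on the order of [V]. The fully invariant subgroups used are the derived subgroup and,
    for abelian [V], the [p]-th powers; when neither is proper and nontrivial, [V] is perfect or
    elementary abelian. *)
Lemma bounded_evper_all d (V : finGroupType) : bounded_evper d V.
Proof.
have [m] := ubnP #|V|; elim: m V => // m IH V; rewrite ltnS => leVm.
have ext (L : {group V}) : (L <| [set: V])%g -> L :!=: 1%g -> L :!=: [set: V] ->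
    (forall f : V -> V, {morph f : v w / (v * w)%g} ->
      forall v, v \in L -> f v \in L) -> bounded_evper d V.
  move=> nL L1 LV fL.
  have cL : #|L| < #|V|.
    rewrite -cardsT; apply: proper_card; rewrite properEneq subsetT andbT.
    exact: LV.
  apply: (bounded_evper_ext nL fL); apply: IH.
    by rewrite card_sub; apply: leq_trans cL leVm.
  rewrite -cardsT -(quotientT L) card_quotient ?normal_norm //.
  apply: leq_trans leVm; rewrite -[X in _ < X]cardsT.
  rewrite -(Lagrange (normal_sub nL)) ltn_Pmull ?indexg_gt0 //.
  by rewrite cardG_gt1.
have [perf|perf] := eqVneq ([set: V]^`(1))%g [set: V]; first exact: bounded_evper_perfect.
have [ab|nab] := eqVneq ([set: V]^`(1))%g 1%g; last first.
  apply: (ext ([set: V]^`(1))%G) => //; first exact: der_normal.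
  move=> f fM v vV.
  have fM' : {in [set: V] &, {morph f : v w / (v * w)%g}} by move=> a b _ _; exact: fM.
  pose g := Morphism fM'.
  have : (g v \in g @* ([set: V]^`(1)))%g by rewrite mem_morphim ?in_setT.
  by rewrite morphim_der //; apply: subsetP; apply: dergS; exact: subsetT.
have abV : abelian [set: V] by apply/derG1P.
have ntV : [set: V]%g != 1%g by apply: contraNneq perf => V1; rewrite ab V1.
have V1 : 1 < #|V| by rewrite -cardsT cardG_gt1.
set p := pdiv #|V|; have p_pr : prime p := pdiv_prime V1.
have powM : {in [set: V] &, {morph (fun v : V => v ^+ p)%g : v w / (v * w)%g}}.
  by move=> v w _ _; apply: expgMn; apply: (centsP abV); rewrite in_setT.
pose pow := Morphism powM.
have powP v : reflect (exists w, v = w ^+ p)%g (v \in pow @* [set: V])%g.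
  apply: (iffP morphimP) => [[w _ _ ->]|[w ->]]; first by exists w.
  by exists w; rewrite ?in_setT.
have [L1|L1] := eqVneq (pow @* [set: V])%g 1%g.
  apply: (@bounded_evper_abelem d V p) => //; rewrite abelemE // abV /=.
  apply/exponentP => v _; have : (v ^+ p \in pow @* [set: V])%g by apply/powP; exists v.
  by rewrite L1 => /set1P.
apply: (ext (pow @* [set: V])%G) => //.
- by rewrite -sub_abelian_normal ?subsetT.
(* By Cauchy's theorem an element of order [p] lies in the kernel of the power map, which is
   therefore not onto. *)
- apply/negP => /eqP LV.
  have pd : p %| #|[set: V]| by rewrite cardsT pdiv_dvd.
  have [x _ ox] := Cauchy p_pr pd.
  have : (x \in 'ker pow)%g by apply/kerP; rewrite ?in_setT //= -ox expg_order.
  have inj : ('injm pow)%g by rewrite -card_im_injm LV.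
  by rewrite ker_injm // => /set1P x1; move: p_pr; rewrite -ox x1 order1.
move=> f fM v /powP[w ->]; apply/powP; exists (f w).
elim: (p) => [|k IHk]; first by apply: (mulgI (f 1%g)); rewrite -fM !mulg1.
by rewrite !expgS fM IHk.
Qed.

(** * Asymptotically uniform automata *)

Section Nuca.

Variables (d : nat) (V : finGroupType).
Local Notation G := 'rV[int]_d.
Local Notation conf := (configuration d V).
Variables (M E : {fset lattice d}) (s : lattice d -> local_map V M) (c : local_map V M).
Hypothesis d0 : 0 < d.
Hypothesis s_hom : forall g, is_grp_hom (s g).
Hypothesis s_c : coincide_outside E s (fun=> c).

Local Notation F := (nuca s).
Local Notation F0 := (nuca (fun=> c)).

Lemma nucaE (t : lattice d -> local_map V M) x g :
  nuca t x g = t g [ffun m => x (g + val m)%R].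
Proof.
rewrite /nuca /restriction; congr (t g _); apply/ffunP => m.
by rewrite !ffunE /shift opprK.
Qed.

(** Sums of at most [k] elements of [M]: the displacements through which [k] steps can read. *)
Fixpoint ball k : seq G :=
  if k is k'.+1 then ball k' ++ [seq (m + b)%R | m <- [seq val m | m : M],
    b <- ball k'] else [:: 0%R].

(** The sites that reach [E] by a displacement in [ball k]; elsewhere [k] steps of the automaton
    only meet the rule [c]. *)
Definition influence k : seq G := [seq (e - b)%R | e <- enum_fset E, b <- ball k].

Lemma ball_leq k l : k <= l -> {subset ball k <= ball l}.
Proof.
move/subnK <-; elim: (l - k) => [//|j IH] b bk.
by rewrite addSn /= mem_cat IH.
Qed.

Lemma ball0 k : 0%R \in ball k.
Proof. by apply: (ball_leq (leq0n k)); rewrite inE. Qed.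

Lemma ballS k (m : M) b : b \in ball k -> (val m + b)%R \in ball k.+1.
Proof.
move=> bk; rewrite /= mem_cat; apply/orP; right.
by apply: allpairs_f => //; apply/mapP; exists m; rewrite ?mem_enum.
Qed.

Lemma influenceP k g : g \notin influence k -> forall b, b \in ball k -> (g + b)%R \notin E.
Proof.
move=> gF b bk; apply: contra gF => gbE.
by apply/allpairsP; exists ((g + b)%R, b); rewrite addrK.
Qed.

Lemma iter_nuca_local k (t : lattice d -> local_map V M) x y g :
  (forall b, b \in ball k -> x (g + b)%R = y (g + b)%R) ->
  iter k (nuca t) x g = iter k (nuca t) y g.
Proof.
elim: k g => [|k IH] g xy; first by have := xy _ (ball0 0); rewrite addr0.
rewrite !iterS !nucaE; congr (t g _); apply/ffunP => m; rewrite !ffunE.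
by apply: IH => b bk; rewrite -addrA; apply: xy; apply: ballS.
Qed.

Lemma iter_nuca_far k x g : g \notin influence k -> iter k F x g = iter k F0 x g.
Proof.
move/influenceP; elim: k g => [|k IH] g gE //.
rewrite !iterS !nucaE s_c; last by have := gE _ (ball0 _); rewrite addr0.
congr (c _); apply/ffunP => m; rewrite !ffunE.
by apply: IH => b bk; rewrite -addrA; apply: gE; apply: ballS.
Qed.

(** As the rank is positive, the vectors with all entries equal are infinitely many. *)
Lemma lattice_fresh (S : seq G) : exists g, g \notin S.
Proof.
apply: NNPP => H.
have inS k : (const_mx k%:Z : G)%R \in S.
  by apply/negPn/negP => nS; apply: H; exists (const_mx k%:Z)%R.
have [i [j [/andP[lij _] /matrixP/(_ 0%R (Ordinal d0))]]] := pigeonhole_seq inS.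
by rewrite !mxE => -[eij]; rewrite eij ltnn in lij.
Qed.

(** Some site lies outside [E], and there [s] takes the value [c]. *)
Lemma const_hom : is_grp_hom c.
Proof.
have [g gE] := lattice_fresh (enum_fset E).
by have := s_hom g; rewrite s_c.
Qed.

Lemma nucaM (t : lattice d -> local_map V M) x y : (forall g, is_grp_hom (t g)) ->
  nuca t (fun k => x k * y k)%g = fun k => (nuca t x k * nuca t y k)%g.
Proof.
move=> t_hom; apply: functional_extensionality => g; rewrite !nucaE -t_hom.
by congr (t g _); apply/ffunP => m; rewrite !ffunE.
Qed.

Lemma gca_nuca : gca F0.
Proof.
split=> [x y g|x h g|].
- by rewrite nucaM // => _; exact: const_hom.
- by rewrite !nucaE; congr (c _); apply/ffunP => m; rewrite !ffunE addrAC.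
exists [seq val m | m : M] => x y xy; rewrite !nucaE; congr (c _).
apply/ffunP => m; rewrite !ffunE add0r; apply: xy.
by apply/mapP; exists m; rewrite ?mem_enum.
Qed.

(** The uniform automaton commutes with translations, so the identity can be checked at a site so
    far from [E] that both automata agree there. *)
Lemma nuca_uniform k l : iter k F =1 iter l F -> iter k F0 =1 iter l F0.
Proof.
move=> e x; have [g] := lattice_fresh (influence k ++ influence l).
rewrite mem_cat negb_or => /andP[gk gl]; apply: functional_extensionality => h.
have -> : h = (g + (h - g))%R by rewrite subrKC.
rewrite -!(gca_shift (gca_iter _ gca_nuca)).
by rewrite -!iter_nuca_far // e.
Qed.

Lemma evper_uniform : evper F -> evper F0.
Proof. by move=> [m [n [n0 e]]]; exists m, n; split=> //; exact: nuca_uniform. Qed.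

Lemma iter_nuca1 k : iter k F (fun=> 1%g) = fun=> 1%g.
Proof.
elim: k => //= k ->; apply: functional_extensionality => g.
have := congr1 (@^~ g) (nucaM (fun=> 1%g) (fun=> 1%g) s_hom).
rewrite (_ : (fun _ => _) = fun=> 1%g); last first.
  by apply: functional_extensionality => k'; rewrite mulg1.
by rewrite -{1}[nuca s _ g]mulg1 => /mulgI.
Qed.

(* Off a finite set all iterates of t = F^n agree with t, and on that finite
   set they depend on finitely many sites, so two of them coincide. *)
Lemma evper_nuca n : 0 < n -> iter (n + n) F0 =1 iter n F0 -> evper F.
Proof.
move=> n0 idn; pose t := iter n F; pose L := influence (n + n).
(* [U] contains the sites that [t] reads from [L], and [W] those that it reads from [U]. *)
pose U := [seq (l + b)%R | l <- L, b <- ball n].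
pose W := [seq (u + b)%R | u <- U, b <- ball n].
have far k x g : g \notin L -> iter k.+1 t x g = t x g.
  move=> gL; elim: k x => // k IH x.
  rewrite iterSr IH /t -iterD iter_nuca_far // idn -iter_nuca_far //.
  apply: contra gL => /allpairsP[[e b] [eE bn ->]]; apply: allpairs_f => //.
  exact: ball_leq (leq_addr n n) _ bn.
have UW u b : u \in U -> b \in ball n -> (u + b)%R \in W by exact: allpairs_f.
have LU l b : l \in L -> b \in ball n -> (l + b)%R \in U by exact: allpairs_f.
have loc k x y : {in W, x =1 y} -> {in L, iter k.+1 t x =1 iter k.+1 t y}.
  move=> xy; elim: k => [|k IH] l lL.
    apply: iter_nuca_local => b bn; apply: xy; rewrite -[(l + b)%R]addr0.
    by rewrite UW ?LU ?ball0.
  rewrite !(iterS k.+1); apply: iter_nuca_local => b bn.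
  have [lbL|lbL] := boolP ((l + b)%R \in L); first exact: IH.
  rewrite !far //; apply: iter_nuca_local => b' bn'.
  by apply: xy; rewrite UW ?LU.
(* Patterns on [W] determine all iterates on [L], so each iterate leaves a trace [r k] in a finite
   type. *)
pose ext (z : {ffun seq_sub W -> V}) : conf := fun g => if insub g is Some w then z w else 1%g.
pose r k := [ffun z => [ffun l : seq_sub L => iter k.+1 t (ext z) (val l)]].
have [i [j [/andP[lij _] eij]]] := @pigeonhole_seq _ r (enum predT) (fun k => mem_enum _ _).
have e : iter i.+1 t =1 iter j.+1 t.
  move=> x; apply: functional_extensionality => g.
  have [gL|gL] := boolP (g \in L); last by rewrite !far.
  pose z : {ffun seq_sub W -> V} := [ffun w => x (val w)].
  have xz : {in W, x =1 ext z}.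
    by move=> w wW; rewrite /ext insubT /= ffunE.
  rewrite !(loc _ _ _ xz) //.
  have /ffunP/(_ z)/ffunP/(_ (SeqSub gL)) := eij.
  by rewrite !ffunE.
exists (i.+1 * n), ((j - i) * n); split; first by rewrite muln_gt0 subn_gt0 lij.
by move=> x; rewrite -mulnDl addnS subnK ?(ltnW lij) // !iterM -e.
Qed.

Lemma ev_per_evper : eventually_periodic F <-> evper F.
Proof.
split=> [[m [n [_ n1 e]]]|[m [n [n1 e]]]].
  by exists m, n; split=> // x; apply: functional_extensionality => g; exact: e.
exists m.+1, n; split=> // x g; by rewrite addnS !iterS e.
Qed.

Variable N : nat.
Hypotheses (N0 : 0 < N)
  (bN : forall F : conf -> conf, gca F -> evper F -> iter (N + N) F =1 iter N F).

Lemma ev_perP : eventually_periodic F <-> iter (N + N) F0 =1 iter N F0.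
Proof.
rewrite ev_per_evper; split; last exact: evper_nuca.
by move=> eF; apply: bN; [exact: gca_nuca | exact: evper_uniform].
Qed.

(** If [F] is periodic, so is the uniform automaton, and an [x] as described is killed by the [N]-th
    iterate of [F], hence trivial. Conversely, triviality of such [x] makes [F] injective, and an
    injective eventually periodic map is periodic. *)
Lemma perP : periodic F <-> iter N F0 =1 id /\
  forall x : conf, (forall g, g \notin influence N -> x g = 1%g) ->
    {in influence N, forall g, iter N F x g = 1%g} -> x = fun=> 1%g.
Proof.
split=> [[n [n1 e]]|[idN ker]].
  have eL : iter n F =1 iter 0 F.
    by move=> x; apply: functional_extensionality => g; exact: e.
  have e0 := nuca_uniform eL.
  have eF0 : evper F0 by exists 0, n; split=> //; rewrite addn0.
  have e0n k x : iter (k * n) F0 x = x.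
    by rewrite iterM; elim: k => //= k ->; rewrite e0.
  have idN : iter N F0 =1 id.
    (* Periodicity puts [x] in the image of the [N]-th iterate, on which that idempotent acts as the
       identity. *)
    move=> x; have ey : iter N F0 (iter (N * n - N) F0 x) = x.
      by rewrite -iterD subnKC ?leq_pmulr // e0n.
    by have := bN gca_nuca eF0 (iter (N * n - N) F0 x); rewrite iterD ey.
  split=> // x xout xin.
  have tx : iter N F x = fun=> 1%g.
    apply: functional_extensionality => g.
    have [gI|gI] := boolP (g \in influence N); first exact: xin.
    by rewrite iter_nuca_far // idN xout.
  have en k : iter (k * n) F x = x.
    by rewrite iterM; elim: k => //= k ->; rewrite eL.
  rewrite -(en N) -[N * n](subnK (leq_pmulr N n1)) iterD tx; exact: iter_nuca1.
have ker1 x : F x = (fun=> 1%g) -> x = fun=> 1%g.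
  move=> Fx; have tx : iter N F x = fun=> 1%g.
    by rewrite -(prednK N0) iterSr Fx iter_nuca1.
  (* The support condition holds automatically: off the influence set [x] equals the [N]-th iterate
     of [F] at [x], which is trivial. *)
  apply: ker => [g gI|g _]; last by rewrite tx.
  by rewrite -[x]idN -iter_nuca_far // tx.
have inj : injective F.
  move=> x y exy; have /ker1 xy : F (fun k => (x k)^-1 * y k)%g = fun=> 1%g.
    apply: functional_extensionality => g.
    have : F (fun k => x k * ((x k)^-1 * y k))%g g = F x g.
      by rewrite exy; congr (F _ g); apply: functional_extensionality => k; rewrite mulKVg.
    by rewrite nucaM // -[RHS]mulg1 => /mulgI.
  apply: functional_extensionality => g; apply/eqP; rewrite eq_mulVg1; apply/eqP.
  exact: (congr1 (@^~ g) xy).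
have [m [n [n1 e]]] : evper F.
  by apply: (@evper_nuca N) => // x; rewrite iterD !idN.
exists n; split=> // x g; congr (_ g).
have : injective (iter m F) by elim: (m) => [|k IH] // x' y' /= /inj/IH.
by apply; rewrite -iterD addnC e.
Qed.

End Nuca.

(** * Computable functions *)

Definition computable (n : nat) (F : seq nat -> nat) : Prop :=
  exists p, forall v, size v = n -> run p v (F v).

Lemma computable_ext n F H : (forall v, size v = n -> F v = H v) -> computable n F ->
  computable n H.
Proof. by move=> e [p rp]; exists p => v sv; rewrite -e //; exact: rp. Qed.

Lemma computable_nth n i : computable n (fun v => nth 0 v i).
Proof. by exists (Proj i). Qed.

Lemma computable_comp m n (H : seq nat -> nat) (Gs : seq (seq nat -> nat)) :
  computable m H -> size Gs = m -> (forall i, i < m -> computable n (nth (fun=> 0) Gs i)) ->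
  computable n (fun v => H [seq G v | G <- Gs]).
Proof.
move=> [p rp] sG cG.
have [ps rps] : exists ps, forall v, size v = n -> forall y,
    run p [seq G v | G <- Gs] y -> run (Comp p ps) v y.
  move: {rp} p => p; rewrite -sG in cG; move: cG {sG} => cG.
  suff [ps H'] : exists ps, forall v, size v = n ->
      (fix runs (gs : seq recfun) (w : seq nat) {struct gs} : Prop :=
         match gs, w with
         | [::], [::] => True
         | g :: gs', a :: w' => run g v a /\ runs gs' w'
         | _, _ => False
         end) ps [seq G v | G <- Gs].
    by exists ps => v sv y rpy; exists [seq G v | G <- Gs] => //; exact: H'.
  elim: Gs cG => [|G Gs IH] cG; first by exists [::].
  have [q rq] := cG 0 isT; have [|ps rps] := IH; first by move=> i li; apply: (cG i.+1).
  by exists (q :: ps) => v sv /=; split; [exact: rq | exact: rps].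
by exists (Comp p ps) => v sv; apply: rps => //; apply: rp; rewrite size_map.
Qed.

(** Recursion and search put their own variables in front, so the parameters reappear as
    [drop k v]. *)
Lemma computable_weaken n k F : computable n F -> computable (k + n) (fun v => F (drop k v)).
Proof.
move=> cF; pose Gs := [seq (fun v : seq nat => nth 0 v i) | i <- iota k n].
apply: (computable_ext _ (computable_comp (n := k + n) (Gs := Gs) cF _ _)).
- move=> v sv; rewrite -map_comp; congr F.
  apply: (@eq_from_nth _ 0); first by rewrite size_map size_iota size_drop sv addKn.
  move=> i; rewrite size_map size_iota => ltin.
  by rewrite (nth_map 0) ?size_iota //= nth_iota // nth_drop.
- by rewrite size_map size_iota.
by move=> i ltin; rewrite (nth_map 0) ?size_iota //; exact: computable_nth.
Qed.

Lemma computable_app1 n (f : nat -> nat) A : computable 1 (fun v => f (nth 0 v 0)) ->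
  computable n A -> computable n (fun v => f (A v)).
Proof. by move=> cf cA; apply: (computable_comp (Gs := [:: A]) cf) => // -[]. Qed.

Lemma computable_app2 n (f : nat -> nat -> nat) A B :
  computable 2 (fun v => f (nth 0 v 0) (nth 0 v 1)) ->
  computable n A -> computable n B -> computable n (fun v => f (A v) (B v)).
Proof. by move=> cf cA cB; apply: (computable_comp (Gs := [:: A; B]) cf) => // -[|[]]. Qed.

Lemma computable_succ n A : computable n A -> computable n (fun v => (A v).+1).
Proof. by apply: (@computable_app1 n succn); exists Succ => -[]. Qed.

Lemma computable_const n k : computable n (fun=> k).
Proof. by elim: k => [|k IH]; [exists Zero | exact: computable_succ]. Qed.

Lemma computable_rec n A B (H : nat -> nat -> seq nat -> nat) :
  computable n A -> computable n B ->
  computable n.+2 (fun w => H (nth 0 w 0) (nth 0 w 1) (drop 2 w)) ->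
  computable n (fun v => nat_rect (fun=> nat) (B v) (fun k z => H k z v) (A v)).
Proof.
move=> cA [pB rB] [pH rH].
(* [Prec] recurses on its first argument; [A v] is substituted for it afterwards by composition. *)
have cP : computable n.+1 (fun w => nat_rect (fun=> nat) (B (behead w))
    (fun k z => H k z (behead w)) (head 0 w)).
  exists (Prec pB pH) => -[|a v] //= [sv].
  exists (nat_rect (fun=> nat) (B v) (fun k z => H k z v)); split=> //=; first exact: rB.
  move=> k _; have := rH (k :: nat_rect (fun=> nat) (B v) (fun k z => H k z v) k :: v).
  by rewrite /= drop0 sv; apply.
pose Gs := A :: [seq (fun v : seq nat => nth 0 v i) | i <- iota 0 n].
apply: (computable_ext _ (computable_comp (n := n) (Gs := Gs) cP _ _)).
- move=> v sv /=; rewrite -map_comp.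
  rewrite (_ : map _ _ = v) // -[RHS](mkseq_nth 0) sv; exact: eq_map.
- by rewrite /= size_map size_iota.
by case=> [|i] //= ltin; rewrite (nth_map 0) ?size_iota //; exact: computable_nth.
Qed.

Lemma computable_mu n (H : nat -> seq nat -> nat) (m : seq nat -> nat) :
  computable n.+1 (fun w => H (nth 0 w 0) (drop 1 w)) ->
  (forall v, size v = n -> H (m v) v = 0 /\ forall k, k < m v -> 0 < H k v) ->
  computable n m.
Proof.
move=> [p rp] Hm; exists (Mu p) => v sv /=; have [Hmv Hk] := Hm v sv.
split; first by have := rp (m v :: v); rewrite /= drop0 sv Hmv; apply.
move=> k /Hk; have := rp (k :: v); rewrite /= drop0 sv => /(_ erefl).
by case: (H k v) => // a ra _; exists a.
Qed.

Definition bcomputable n (b : seq nat -> bool) := computable n (fun v => nat_of_bool (b v)).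

(** A primitive recursion of length [b v], that is 0 or 1. *)
Lemma computable_if n b A B : bcomputable n b -> computable n A -> computable n B ->
  computable n (fun v => if b v then A v else B v).
Proof.
move=> cb cA cB.
have := computable_rec (H := fun _ _ v => A v) cb cB (computable_weaken 2 cA).
by apply: computable_ext => v _ /=; case: (b v).
Qed.

Lemma computable_addn n A B : computable n A -> computable n B -> computable n (fun v =>
  A v + B v).
Proof.
apply: computable_app2; have := computable_rec (H := fun _ z _ =>
  z.+1) (computable_nth 2 0) (computable_nth 2 1)
  (computable_succ (computable_nth 4 1)).
by apply: computable_ext => v _ /=; elim: (nth 0 v 0) => //= k ->.
Qed.

Lemma computable_muln n A B : computable n A -> computable n B -> computable n (fun v =>
  A v * B v).
Proof.
apply: computable_app2; have := computable_rec (H := fun _ z v =>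
  nth 0 v 1 + z) (computable_nth 2 0) (computable_const 2 0)
  (computable_addn (computable_weaken 2 (computable_nth 2 1)) (computable_nth 4 1)).
by apply: computable_ext => v _ /=; elim: (nth 0 v 0) => //= k ->; rewrite mulSn.
Qed.

Lemma computable_pred n A : computable n A -> computable n (fun v => (A v).-1).
Proof.
apply: computable_app1; have := computable_rec (H := fun k _ _ =>
  k) (computable_nth 1 0) (computable_const 1 0) (computable_nth 3 0).
by apply: computable_ext => v _ /=; case: (nth 0 v 0).
Qed.

Lemma computable_subn n A B : computable n A -> computable n B -> computable n (fun v =>
  A v - B v).
Proof.
apply: computable_app2; have := computable_rec (H := fun _ z _ =>
  z.-1) (computable_nth 2 1) (computable_nth 2 0)
  (computable_pred (computable_nth 4 1)).
apply: computable_ext => v _ /=.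
by elim: (nth 0 v 1) => [|k /= ->]; rewrite ?subn0 // subnS.
Qed.

Lemma computable_eq0 n A : computable n A -> bcomputable n (fun v => A v == 0).
Proof.
apply: (@computable_app1 n (fun a => nat_of_bool (a == 0))).
have := computable_rec (H := fun _ _ _ =>
  0) (computable_nth 1 0) (computable_const 1 1) (computable_const 3 0).
by apply: computable_ext => v _ /=; case: (nth 0 v 0).
Qed.

Lemma computable_leq n A B : computable n A -> computable n B -> bcomputable n (fun v =>
  A v <= B v).
Proof. by move=> cA cB; exact: computable_eq0 (computable_subn cA cB). Qed.

Lemma computable_and n a b : bcomputable n a -> bcomputable n b -> bcomputable n (fun v =>
  a v && b v).
Proof.
move=> ca cb; have := computable_muln ca cb; apply: computable_ext => v _.
by rewrite mulnb.
Qed.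

Lemma computable_neg n a : bcomputable n a -> bcomputable n (fun v => ~~ a v).
Proof. by move=> ca; have := computable_eq0 ca; apply: computable_ext => v _; case: (a v). Qed.

Lemma computable_or n a b : bcomputable n a -> bcomputable n b -> bcomputable n (fun v =>
  a v || b v).
Proof.
move=> ca cb; have := computable_neg (computable_and (computable_neg ca) (computable_neg cb)); apply: computable_ext => v _.
by rewrite negb_and !negbK.
Qed.

Lemma computable_eqn n A B : computable n A -> computable n B -> bcomputable n (fun v =>
  A v == B v).
Proof.
move=> cA cB; have := computable_and (computable_leq cA cB) (computable_leq cB cA); apply:
  computable_ext => v _.
by rewrite eqn_leq.
Qed.

Lemma computable_odd n A : computable n A -> bcomputable n (fun v => odd (A v)).
Proof.
apply: (@computable_app1 n (fun a => nat_of_bool (odd a))).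
have := computable_rec (H := fun _ z _ =>
  nat_of_bool (z == 0)) (computable_nth 1 0) (computable_const 1 0)
  (computable_eq0 (computable_nth 3 1)).
by apply: computable_ext => v _ /=; elim: (nth 0 v 0) => //= k ->; case: (odd k).
Qed.

Lemma computable_half n A : computable n A -> computable n (fun v => (A v)./2).
Proof.
apply: computable_app1.
have := computable_rec (H := fun k z _ =>
  nat_of_bool (odd k) + z) (computable_nth 1 0) (computable_const 1 0)
  (computable_addn (computable_odd (computable_nth 3 0)) (computable_nth 3 1)).
by apply: computable_ext => v _ /=; elim: (nth 0 v 0) => //= k ->; rewrite uphalf_half.
Qed.

Lemma computable_iter n (f : nat -> nat) A B : computable 1 (fun v => f (nth 0 v 0)) ->
  computable n A -> computable n B -> computable n (fun v => iter (A v) f (B v)).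
Proof.
move=> cf cA cB; have := computable_rec (H := fun _ z _ =>
  f z) cA cB (computable_app1 cf (computable_nth _ 1)).
by apply: computable_ext => v _ /=; elim: (A v) => //= k ->.
Qed.

(** * Lists of numbers coded by numbers *)

Notation cod := CodeSeq.code.
Notation dec := CodeSeq.decode.

(** The code of [a :: l] is [2 ^ a * (cod l).*2.+1], and that of the empty list is 0. *)
Lemma computable_cons n A L : computable n A -> computable n L ->
  computable n (fun v => cod (A v :: dec (L v))).
Proof.
move=> cA cL.
have cX : computable n (fun v => iter (A v) (fun k => k + k) 1).
  by apply: computable_iter => //; [apply: computable_addn; exact: computable_nth | exact:
    computable_const].
have := computable_muln cX (computable_succ (computable_addn cL cL)); apply:
  computable_ext => v _.
rewrite /= CodeSeq.decodeK -addnn; congr (_ * _).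
by elim: (A v) => //= k ->; rewrite expnS mul2n addnn.
Qed.

Lemma iter_half k m i : i <= k -> iter i half (2 ^ k * m) = 2 ^ (k - i) * m.
Proof.
elim: i => [|i IH] ltik; first by rewrite subn0.
rewrite iterS IH ?(ltnW ltik) // -(subnSK ltik) expnS -mulnA mul2n doubleK //.
Qed.

(** The head is the exponent of 2 in the code, found by halving until an odd number appears. Code 0
    stops the search at once, with the default 0. *)
Lemma computable_head n L : computable n L -> computable n (fun v => head 0 (dec (L v))).
Proof.
apply: (computable_app1 (f := fun l => head 0 (dec l))).
have cH : bcomputable 2 (fun w => ~~ ((nth 0 (drop 1 w) 0 == 0)
      || odd (iter (nth 0 w 0) half (nth 0 (drop 1 w) 0)))).
  have cl := computable_weaken 1 (computable_nth 1 0).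
  apply/computable_neg/computable_or; first exact: computable_eq0.
  by apply/computable_odd/computable_iter => //; [apply: computable_half | ]; exact:
    computable_nth.
apply: (computable_mu cH (H := fun k v => nat_of_bool (~~ ((nth 0 v 0 == 0)
      || odd (iter k half (nth 0 v 0)))))) => v _.
rewrite -[nth 0 v 0]CodeSeq.decodeK; case: (dec _) => [|a l]; first by [].
rewrite CodeSeq.codeK /= iter_half // subnn mul1n oddS odd_double orbT; split=> // k ltk.
rewrite iter_half ?(ltnW ltk) // -(subnSK ltk) expnS -mulnA mul2n odd_double orbF.
by rewrite muln_eq0 expn_eq0.
Qed.

(** Halving as often as the head says leaves [(cod l).*2.+1]; one more halving gives [cod l]. *)
Lemma computable_behead n L : computable n L -> computable n (fun v =>
  cod (behead (dec (L v)))).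
Proof.
move=> cL; have := computable_half (computable_iter (computable_half (computable_nth 1 0)) (computable_head cL) cL).
apply: computable_ext => v _; rewrite -{2}[L v]CodeSeq.decodeK.
case: (dec (L v)) => [|a l] //=.
by rewrite iter_half // subnn mul1n -uphalfE uphalf_double.
Qed.

Lemma iter_behead i l : iter i (fun l => cod (behead (dec l))) l = cod (drop i (dec l)).
Proof.
elim: i => [|i IH]; first by rewrite drop0 CodeSeq.decodeK.
by rewrite iterS IH CodeSeq.codeK -drop1 drop_drop add1n.
Qed.

Lemma computable_drop n A L : computable n A -> computable n L ->
  computable n (fun v => cod (drop (A v) (dec (L v)))).
Proof.
move=> cA cL; have := computable_iter (f := fun l =>
  cod (behead (dec l))) (computable_behead (computable_nth 1 0)) cA cL.
by apply: computable_ext => v _; rewrite iter_behead.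
Qed.

Lemma computable_nthl n A L : computable n A -> computable n L ->
  computable n (fun v => nth 0 (dec (L v)) (A v)).
Proof.
move=> cA cL; have := computable_head (computable_drop cA cL); apply: computable_ext => v _.
by rewrite CodeSeq.codeK -nth0 nth_drop addn0.
Qed.

Lemma cod_eq0 l : (cod l == 0) = (l == [::]).
Proof. by case: l => //= a l; rewrite muln_eq0 expn_eq0. Qed.

Lemma computable_size n L : computable n L -> computable n (fun v => size (dec (L v))).
Proof.
apply: (computable_app1 (f := fun l => size (dec l))).
have cH := computable_drop (computable_nth 2 0) (computable_weaken 1 (computable_nth 1 0)).
apply: (computable_mu (H := fun k v => cod (drop k (dec (nth 0 v 0)))) cH) => v _.
rewrite drop_size; split=> // k ltk; rewrite lt0n cod_eq0 -size_eq0 size_drop.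
by rewrite -lt0n subn_gt0.
Qed.

Lemma computable_foldr n (H : nat -> nat -> seq nat -> nat) L B :
  computable n L -> computable n B ->
  computable n.+2 (fun w => H (nth 0 w 0) (nth 0 w 1) (drop 2 w)) ->
  computable n (fun v => foldr (fun a z => H a z v) (B v) (dec (L v))).
Proof.
move=> cL cB cH.
(* [foldr] consumes the list from its end, so step [k] reads the entry of index [size - k.+1]. *)
pose H' k z v := H (nth 0 (dec (L v)) (size (dec (L v)) - k.+1)) z v.
have cH' : computable n.+2 (fun w => H' (nth 0 w 0) (nth 0 w 1) (drop 2 w)).
  have cL2 := computable_weaken 2 cL.
  have ci := computable_nthl (computable_subn (computable_size cL2) (computable_succ (computable_nth _ 0))) cL2.
  pose Gs := (fun w => nth 0 (dec (L (drop 2 w))) (size (dec (L (drop 2 w))) - (nth 0 w 0).+1))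
    :: (fun w => nth 0 w 1) :: [seq (fun v : seq nat => nth 0 v i) | i <- iota 2 n].
  apply: (computable_ext _ (computable_comp (n := n.+2) (Gs := Gs) cH _ _)).
  - move=> w sw; rewrite /= drop0 -map_comp /H'; congr (H _ _ _).
    apply: (@eq_from_nth _ 0); rewrite size_map size_iota ?size_drop ?sw ?subn2 // => i lti.
    by rewrite (nth_map 0) ?size_iota //= nth_iota // nth_drop.
  - by rewrite /= size_map size_iota.
  case=> [|[|i]] //= ltin; first exact: computable_nth.
  by rewrite (nth_map 0) ?size_iota //; exact: computable_nth.
have := computable_rec (computable_size cL) cB cH'; apply: computable_ext => v _; set l :=
  dec (L v).
suff e k : k <= size l -> nat_rect (fun=> nat) (B v) (fun k z => H' k z v) k =
    foldr (fun a z => H a z v) (B v) (drop (size l - k) l).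
  by rewrite e // subnn drop0.
elim: k => [_|k IH ltk]; first by rewrite subn0 drop_size.
rewrite /= IH ?(ltnW ltk) // /H' -/l.
have lt : size l - k.+1 < size l by rewrite -subSn // subSS leq_subr.
by rewrite [in RHS](drop_nth 0 lt) /= subnSK.
Qed.

Lemma computable_bforall n (b : nat -> seq nat -> bool) K :
  computable n K -> bcomputable n.+1 (fun w => b (nth 0 w 0) (drop 1 w)) ->
  bcomputable n (fun v => all (fun t => b t v) (iota 0 (K v))).
Proof.
move=> cK cb.
have cb' : bcomputable n.+2 (fun w => b (nth 0 w 0) (drop 2 w)).
  pose Gs := (fun w => nth 0 w 0) :: [seq (fun v : seq nat => nth 0 v i) | i <- iota 2 n].
  apply: (computable_ext _ (computable_comp (n := n.+2) (Gs := Gs) cb _ _)).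
  - move=> w sw; rewrite /= drop0 -map_comp; congr (nat_of_bool (b _ _)).
    apply: (@eq_from_nth _ 0); rewrite size_map size_iota ?size_drop ?sw ?subn2 // => i lti.
    by rewrite (nth_map 0) ?size_iota //= nth_iota // nth_drop.
  - by rewrite /= size_map size_iota.
  case=> [|i] //= ltin; first exact: computable_nth.
  by rewrite (nth_map 0) ?size_iota //; exact: computable_nth.
have := computable_rec (H := fun k z v =>
  z * b k v) cK (computable_const n 1) (computable_muln (computable_nth _ 1) cb').
apply: computable_ext => v _; elim: (K v) => // k IH.
rewrite -[k.+1 in RHS]addn1 iotaD all_cat /= IH andbT.
by rewrite mulnb.
Qed.

Lemma computable_map n (H : nat -> seq nat -> nat) L :
  computable n L -> computable n.+2 (fun w => H (nth 0 w 0) (drop 2 w)) ->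
  computable n (fun v => cod [seq H a v | a <- dec (L v)]).
Proof.
move=> cL cH.
have := computable_foldr (H := fun a z v => cod (H a v ::
  dec z)) cL (computable_const n 0) (computable_cons cH (computable_nth _ 1)).
apply: computable_ext => v _; elim: (dec (L v)) => //= a l ->.
by rewrite CodeSeq.decodeK.
Qed.

Lemma computable_cat n L L' : computable n L -> computable n L' ->
  computable n (fun v => cod (dec (L v) ++ dec (L' v))).
Proof.
move=> cL cL'.
have := computable_foldr (H := fun a z v => cod (a ::
  dec z)) cL cL' (computable_cons (computable_nth _ 0) (computable_nth _ 1)).
apply: computable_ext => v _; elim: (dec (L v)) => [|a l IH] /=;
  first by rewrite CodeSeq.decodeK.
by rewrite CodeSeq.decodeK IH.
Qed.

Lemma computable_flatmap n (H : nat -> seq nat -> nat) L :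
  computable n L -> computable n.+2 (fun w => H (nth 0 w 0) (drop 2 w)) ->
  computable n (fun v => cod (flatten [seq dec (H a v) | a <- dec (L v)])).
Proof.
move=> cL cH.
have := computable_foldr (H := fun a z v =>
  cod (dec (H a v) ++ dec z)) cL (computable_const n 0)
  (computable_cat cH (computable_nth _ 1)).
apply: computable_ext => v _; elim: (dec (L v)) => //= a l ->.
by rewrite CodeSeq.codeK.
Qed.

Lemma computable_all n (b : nat -> seq nat -> bool) L :
  computable n L -> bcomputable n.+2 (fun w => b (nth 0 w 0) (drop 2 w)) ->
  bcomputable n (fun v => all (fun a => b a v) (dec (L v))).
Proof.
move=> cL cb.
have := computable_foldr (H := fun a z v =>
  b a v * z) cL (computable_const n 1) (computable_muln cb (computable_nth _ 1)).
by apply: computable_ext => v _; elim: (dec (L v)) => //= a l ->; rewrite mulnb.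
Qed.

(** * The decision procedures *)

Section Algorithm.

Variables (d n u : nat).

(** Table entries carry the value at the head and the pattern as tail, the layout of
    [code_local_map]. *)
Definition lookup (key tab : nat) : nat :=
  foldr (fun e z => if cod (behead (dec e)) == key then head 0 (dec e) else z) 0 (dec tab).

(** This serves two association lists: the exceptional local maps, with [c] as default, and finite
    configurations, with the neutral state as default. *)
Definition assoc (key dflt l : nat) : nat :=
  foldr (fun e z => if head 0 (dec e) == key then nth 0 (dec e) 1 else z) dflt (dec l).

(** [int_pos] and [int_neg] read the positive and negative parts off a [code_int]: even codes are
    nonnegative integers, odd ones negative. *)
Definition int_pos z := if odd z then 0 else z./2.
Definition int_neg z := if odd z then z./2.+1 else 0.
(** The [code_int] of the integer difference of [p] and [q]. The predecessor accounts for [Negz k]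
    meaning [-(k.+1)]. *)
Definition int_diff p q := if q <= p then (p - q) + (p - q) else ((q - p) + (q - p)).-1.

(** The detour [dec (cod _)], here and below, gives the expression the shape required by the
    computability lemmas on coded lists. *)
Definition point_add g h : nat :=
  cod [seq (let y := nth 0 (dec g) i in let z := nth 0 (dec h) i in
            int_diff (int_pos y + int_pos z) (int_neg y + int_neg z)) | i <- dec (cod (iota 0 d))].
Definition point_sub g h : nat :=
  cod [seq (let y := nth 0 (dec g) i in let z := nth 0 (dec h) i in
            int_diff (int_pos y + int_neg z) (int_neg y + int_pos z)) | i <- dec (cod (iota 0 d))].

(** Every number [t] denotes a configuration supported in [X]: invalid states are read as [u]. The
    tests can thus run through all numbers up to a bound. *)
Definition conf_code X t g : nat :=
  if ~~ all (fun h => h != g) (dec X) && (assoc g u t < n) then assoc g u t else u.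

(** The recursion on [k] is unrolled when the program is built, since only a fixed [k] is needed. *)
Fixpoint eval_code k Mc Ec cc X t g : nat :=
  if k is k'.+1 then
    lookup (cod [seq eval_code k' Mc Ec cc X t (point_add g m) | m <- dec Mc]) (assoc g cc Ec)
  else conf_code X t g.

Fixpoint ball_code k Mc : nat :=
  if k is k'.+1 then
    cod (dec (ball_code k' Mc) ++
      dec (cod (flatten [seq dec (cod [seq point_add m b | b <- dec (ball_code k' Mc)]) | m <- dec Mc])))
  else cod [:: cod (nseq d 0)].

Definition influence_code k Mc Ec : nat :=
  cod (flatten [seq dec (cod [seq point_sub (head 0 (dec e)) b | b <- dec (ball_code k Mc)]) | e <- dec Ec]).

(** Coding is monotone in each entry, so assigning to every site the number [n], larger than all
    states, bounds the codes of all configurations on [X]. *)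
Definition bound X : nat := cod [seq cod (g :: dec (cod [:: n])) | g <- dec X].

(** By translation invariance the origin suffices, and for [l <= k] the values there depend on
    [ball k] only. The argument 0 codes an empty list of exceptions. *)
Definition iter_eq_test k l Mc cc : bool :=
  all (fun t => eval_code k Mc 0 cc (ball_code k Mc) t (cod (nseq d 0))
             == eval_code l Mc 0 cc (ball_code k Mc) t (cod (nseq d 0)))
    (iota 0 (bound (ball_code k Mc)).+1).

Definition kernel_test k Mc Ec cc : bool :=
  all (fun t => ~~ all (fun g => eval_code k Mc Ec cc (influence_code k Mc Ec) t g == u)
                       (dec (influence_code k Mc Ec))
             || all (fun g => conf_code (influence_code k Mc Ec) t g == u)
                    (dec (influence_code k Mc Ec)))
    (iota 0 (bound (influence_code k Mc Ec)).+1).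

Lemma computable_lookup m A L : computable m A -> computable m L ->
  computable m (fun v => lookup (A v) (L v)).
Proof.
move=> cA cL; apply: (computable_foldr (H := fun e z v =>
  if cod (behead (dec e)) == A v then head 0 (dec e) else z) cL (computable_const _ 0)).
apply: computable_if; [apply: computable_eqn | apply: computable_head | ]; try exact:
  computable_nth.
  by apply: computable_behead; exact: computable_nth.
exact: (computable_weaken 2 cA).
Qed.

Lemma computable_assoc m A B L : computable m A -> computable m B -> computable m L ->
  computable m (fun v => assoc (A v) (B v) (L v)).
Proof.
move=> cA cB cL; apply: (computable_foldr (H := fun e z v =>
  if head 0 (dec e) == A v then nth 0 (dec e) 1 else z) cL cB).
apply: computable_if; [apply: computable_eqn | apply: computable_nthl | ]; try exact:
  computable_nth.
- by apply: computable_head; exact: computable_nth.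
- exact: (computable_weaken 2 cA).
exact: computable_const.
Qed.

Lemma computable_int_pos m A : computable m A -> computable m (fun v => int_pos (A v)).
Proof. by move=> cA; apply: computable_if; [exact: computable_odd | exact:
  computable_const | exact: computable_half]. Qed.

Lemma computable_int_neg m A : computable m A -> computable m (fun v => int_neg (A v)).
Proof.
by move=> cA; apply: computable_if; [exact:
  computable_odd | apply/computable_succ/computable_half | exact: computable_const].
Qed.

Lemma computable_int_diff m A B : computable m A -> computable m B ->
  computable m (fun v => int_diff (A v) (B v)).
Proof.
move=> cA cB; apply: computable_if; [exact: computable_leq | apply: computable_addn; exact:
  computable_subn | ].
by apply/computable_pred/computable_addn; exact: computable_subn.
Qed.

Lemma computable_point_add m A B : computable m A -> computable m B ->
  computable m (fun v => point_add (A v) (B v)).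
Proof.
move=> cA cB; apply: (computable_map (H := fun i v =>
  let y := nth 0 (dec (A v)) i in let z := nth 0 (dec (B v)) i in
  int_diff (int_pos y + int_pos z) (int_neg y + int_neg z)) (computable_const m _)).
have cy := computable_nthl (computable_nth m.+2 0) (computable_weaken 2 cA).
have cz := computable_nthl (computable_nth m.+2 0) (computable_weaken 2 cB).
by apply: computable_int_diff; apply: computable_addn; (exact: computable_int_pos || exact:
  computable_int_neg).
Qed.

Lemma computable_point_sub m A B : computable m A -> computable m B ->
  computable m (fun v => point_sub (A v) (B v)).
Proof.
move=> cA cB; apply: (computable_map (H := fun i v =>
  let y := nth 0 (dec (A v)) i in let z := nth 0 (dec (B v)) i in
  int_diff (int_pos y + int_neg z) (int_neg y + int_pos z)) (computable_const m _)).
have cy := computable_nthl (computable_nth m.+2 0) (computable_weaken 2 cA).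
have cz := computable_nthl (computable_nth m.+2 0) (computable_weaken 2 cB).
by apply: computable_int_diff; apply: computable_addn; (exact: computable_int_pos || exact:
  computable_int_neg).
Qed.

Lemma computable_conf_code m X t g : computable m X -> computable m t -> computable m g ->
  computable m (fun v => conf_code (X v) (t v) (g v)).
Proof.
move=> cX ct cg; have ca := computable_assoc cg (computable_const m u) ct.
apply: computable_if => //; last exact: computable_const.
apply: computable_and; last by apply:
  computable_leq (computable_succ ca) (computable_const m n).
apply/computable_neg/(computable_all (b := fun h v => h != g v)) => //.
by apply/computable_neg/computable_eqn; [exact: computable_nth | exact:
  (computable_weaken 2 cg)].
Qed.

Lemma computable_ev k m Mc Ec cc X t g :
  computable m Mc -> computable m Ec -> computable m cc ->
  computable m X -> computable m t -> computable m g ->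
  computable m (fun v => eval_code k (Mc v) (Ec v) (cc v) (X v) (t v) (g v)).
Proof.
elim: k m Mc Ec cc X t g => [|k IH] m Mc Ec cc X t g cM cE cc' cX ct cg.
  exact: computable_conf_code.
apply: computable_lookup; last exact: computable_assoc.
apply: (computable_map (H := fun a v =>
  eval_code k (Mc v) (Ec v) (cc v) (X v) (t v) (point_add (g v) a))) => //.
apply: IH; last by apply: computable_point_add; [exact: (computable_weaken 2 cg) | exact:
  computable_nth].
- exact: (computable_weaken 2 cM).
- exact: (computable_weaken 2 cE).
- exact: (computable_weaken 2 cc').
- exact: (computable_weaken 2 cX).
- exact: (computable_weaken 2 ct).
Qed.

Lemma computable_ball k m Mc : computable m Mc -> computable m (fun v => ball_code k (Mc v)).
Proof.
elim: k m Mc => [|k IH] m Mc cM; first exact: computable_const.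
apply: computable_cat; first exact: IH.
apply: (computable_flatmap (H := fun a v =>
  cod [seq point_add a b | b <- dec (ball_code k (Mc v))])) => //.
apply: (computable_map (H := fun b v => point_add (nth 0 v 0) b)).
  by apply: IH; exact: (computable_weaken 2 cM).
by apply: computable_point_add; [exact: (computable_weaken 2 (computable_nth _ 0)) | exact:
  computable_nth].
Qed.

Lemma computable_influence k m Mc Ec : computable m Mc -> computable m Ec ->
  computable m (fun v => influence_code k (Mc v) (Ec v)).
Proof.
move=> cM cE.
apply: (computable_flatmap (H := fun e v =>
  cod [seq point_sub (head 0 (dec e)) b | b <- dec (ball_code k (Mc v))])) => //.
apply: (computable_map (H := fun b v => point_sub (head 0 (dec (nth 0 v 0))) b)).
  by apply: computable_ball; exact: (computable_weaken 2 cM).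
apply: computable_point_sub; last exact: computable_nth.
by apply: computable_head; exact: (computable_weaken 2 (computable_nth _ 0)).
Qed.

Lemma computable_bound m X : computable m X -> computable m (fun v => bound (X v)).
Proof.
move=> cX; apply: (computable_map (H := fun g v => cod (g :: dec (cod [:: n])))) => //.
by apply: computable_cons; [exact: computable_nth | exact: computable_const].
Qed.

Lemma computable_iter_eq_test k l m Mc cc : computable m Mc -> computable m cc ->
  bcomputable m (fun v => iter_eq_test k l (Mc v) (cc v)).
Proof.
move=> cM cc'.
apply: (computable_bforall (b := fun t v =>
  eval_code k (Mc v) 0 (cc v) (ball_code k (Mc v)) t (cod (nseq d 0))
             == eval_code l (Mc v) 0 (cc v) (ball_code k (Mc v)) t (cod (nseq d 0)))).
  by apply/computable_succ/computable_bound/computable_ball.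
have cM1 := computable_weaken 1 cM; have cc1 := computable_weaken 1 cc'.
by apply: computable_eqn; apply: computable_ev => //; (exact: computable_const || exact:
  computable_nth || exact: computable_ball).
Qed.

Lemma computable_kernel_test k m Mc Ec cc : computable m Mc -> computable m Ec ->
  computable m cc ->
  bcomputable m (fun v => kernel_test k (Mc v) (Ec v) (cc v)).
Proof.
move=> cM cE cc'.
pose I v := influence_code k (Mc v) (Ec v).
have cI : computable m I by exact: computable_influence.
apply: (computable_bforall (b := fun t v => ~~ all (fun g =>
  eval_code k (Mc v) (Ec v) (cc v) (I v) t g == u) (dec (I v))
             || all (fun g => conf_code (I v) t g == u) (dec (I v)))).
  exact/computable_succ/computable_bound.
have cM1 := computable_weaken 1 cM; have cc1 := computable_weaken 1 cc'; have cE1 :=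
  computable_weaken 1 cE.
have cI1 := computable_weaken 1 cI.
have cg := computable_nth m.+3 0; have ct := computable_weaken 2 (computable_nth m.+1 0).
apply: computable_or.
  apply/computable_neg/(computable_all (b := fun g w =>
    eval_code k (Mc (drop 1 w)) (Ec (drop 1 w)) (cc (drop 1 w)) (I (drop 1 w)) (nth 0 w 0) g == u)) => //.
  apply: computable_eqn; last exact: computable_const.
  apply: computable_ev => //.
  - exact: (computable_weaken 2 cM1).
  - exact: (computable_weaken 2 cE1).
  - exact: (computable_weaken 2 cc1).
  - exact: (computable_weaken 2 cI1).
apply: (computable_all (b := fun g w => conf_code (I (drop 1 w)) (nth 0 w 0) g == u)) => //.
apply: computable_eqn; last exact: computable_const.
by apply: computable_conf_code => //; exact: (computable_weaken 2 cI1).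
Qed.

End Algorithm.

(** * Correctness of the codes and of the tests *)

Local Arguments CodeSeq.code : simpl never.

Lemma code_intK z : ((int_pos (code_int z))%:Z - (int_neg (code_int z))%:Z = z)%R.
Proof.
by case: z => k; rewrite /int_pos /int_neg /= ?odd_double /= ?doubleK ?uphalf_double; lia.
Qed.

Lemma code_int_sub p q : code_int (p%:Z - q%:Z)%R = int_diff p q.
Proof.
rewrite /int_diff; case: leqP => le.
  have -> : (p%:Z - q%:Z = (p - q)%N%:Z)%R by lia.
  by rewrite /= addnn.
have -> : (p%:Z - q%:Z = - (q - p).-1.+1%:Z)%R by lia.
by rewrite -NegzE /=; lia.
Qed.

Lemma leq_cod_map (T : Type) (f h : T -> nat) l :
  (forall a, f a <= h a) -> cod [seq f a | a <- l] <= cod [seq h a | a <- l].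
Proof.
move=> fh; elim: l => //= a l IH.
by rewrite leq_mul ?leq_exp2l // ltnS leq_double.
Qed.

Section Correct.

Variables (d : nat) (V : finGroupType).
Local Notation G := 'rV[int]_d.
Local Notation conf := (configuration d V).
Local Notation n := #|V|.
Local Notation u := (code_elt (1%g : V)).
Local Notation pt := (@code_point d).

Lemma dec_pt g (i : 'I_d) : nth 0 (dec (pt g)) i = code_int (g 0%R i).
Proof.
by rewrite CodeSeq.codeK (nth_map i) ?size_enum_ord // nth_ord_enum.
Qed.

Lemma pt_inj : injective pt.
Proof.
move=> g h e; apply/matrixP => i j; rewrite ord1.
by rewrite -[LHS]code_intK -[RHS]code_intK -!dec_pt e.
Qed.

Lemma ptE g : pt g = cod [seq code_int (g 0%R i) | i <- enum 'I_d].
Proof. by []. Qed.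

Lemma point_addE g h : point_add d (pt g) (pt h) = pt (g + h)%R.
Proof.
rewrite /point_add CodeSeq.codeK -val_enum_ord -map_comp ptE; congr cod.
apply: eq_map => i /=; rewrite !dec_pt mxE -code_int_sub; congr code_int.
rewrite -[in RHS](code_intK (g 0%R i)) -[in RHS](code_intK (h 0%R i)).
by rewrite !PoszD opprD addrACA.
Qed.

Lemma point_subE g h : point_sub d (pt g) (pt h) = pt (g - h)%R.
Proof.
rewrite /point_sub CodeSeq.codeK -val_enum_ord -map_comp ptE; congr cod.
apply: eq_map => i /=; rewrite !dec_pt !mxE -code_int_sub; congr code_int.
rewrite -[in RHS](code_intK (g 0%R i)) -[in RHS](code_intK (h 0%R i)).
by lia.
Qed.

Lemma pt0 : pt 0%R = cod (nseq d 0).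
Proof.
rewrite ptE; congr cod; rewrite -[in RHS](size_enum_ord d).
by elim: (enum _) => //= i l ->; rewrite mxE.
Qed.

Definition elt k : V := nth 1%g (enum V) k.

Lemma code_eltK : cancel (@code_elt V) elt.
Proof. by move=> v; rewrite /elt /code_elt nth_enum_rank. Qed.

Lemma code_elt_lt (v : V) : code_elt v < n. Proof. exact: ltn_ord. Qed.

Lemma eltK k : k < n -> code_elt (elt k) = k.
Proof.
by move=> ltk; rewrite /elt -(enum_val_nth 1%g (Ordinal ltk)) /code_elt enum_valK.
Qed.

Lemma code_elt_inj : injective (@code_elt V).
Proof. exact: can_inj code_eltK. Qed.

Definition conf_of X t : conf := fun g => elt (conf_code n u X t (pt g)).

Lemma conf_ofE X t g : code_elt (conf_of X t g) = conf_code n u X t (pt g).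
Proof.
rewrite eltK // /conf_code; case: ifP => [/andP[]//|_]; exact: code_elt_lt.
Qed.

Lemma assocE g dflt (f : G -> nat) Es :
  assoc (pt g) dflt (cod [seq cod [:: pt h; f h] | h <- Es]) = if g \in Es then f g else dflt.
Proof.
rewrite /assoc CodeSeq.codeK; elim: Es => //= h Es IH.
rewrite CodeSeq.codeK /= (inj_eq pt_inj) inE eq_sym IH.
by case: eqVneq => [->|].
Qed.

Lemma lookupE (M : {fset lattice d}) (f : local_map V M) (a : {ffun M -> V}) :
  lookup (cod [seq code_elt (a m) | m : M]) (code_local_map f) = code_elt (f a).
Proof.
rewrite /lookup /code_local_map CodeSeq.codeK /image_mem.
have : a \in enum {: {ffun M -> V}} by rewrite mem_enum.
elim: (enum _) => // b l IH; rewrite in_cons map_cons /= CodeSeq.codeK /=.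
case: ifP => [/eqP e _|/eqP ne /orP[/eqP e|/IH//]].
  have {}e := can_inj CodeSeq.codeK e.
  congr (code_elt (f _)); apply/ffunP => m; apply: code_elt_inj.
  by move/eq_in_map: e => -> //; rewrite mem_enum.
by case: ne; rewrite e.
Qed.

Lemma mem_pt g Xs : (~~ all (fun h => h != pt g) [seq pt h | h <- Xs]) = (g \in Xs).
Proof.
rewrite -has_predC has_map -has_pred1; apply: eq_has => h /=.
by rewrite negbK (inj_eq pt_inj).
Qed.

Lemma conf_of_out Xs t g : g \notin Xs -> conf_of (cod [seq pt h | h <- Xs]) t g = 1%g.
Proof.
move=> gX; apply: code_elt_inj; rewrite conf_ofE /conf_code CodeSeq.codeK mem_pt.
by rewrite (negPf gX).
Qed.

Lemma conf_code_bounded (x : conf) Xs : exists2 t,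
  t \in iota 0 (bound n (cod [seq pt h | h <- Xs])).+1 &
  {in Xs, conf_of (cod [seq pt h | h <- Xs]) t =1 x}.
Proof.
exists (cod [seq cod [:: pt h; code_elt (x h)] | h <- Xs]).
  rewrite mem_iota add0n ltnS /= /bound !CodeSeq.codeK -map_comp.
  apply: leq_cod_map => h; rewrite /CodeSeq.code /= leq_mul // ltnS leq_double.
  by rewrite !muln1 leq_exp2l // ltnW ?code_elt_lt.
move=> g gX; apply: code_elt_inj.
rewrite conf_ofE /conf_code CodeSeq.codeK mem_pt assocE gX /=.
by rewrite code_elt_lt.
Qed.

Section Data.

Variables (M : {fset lattice d}) (Es : seq G).
Variables (s : lattice d -> local_map V M) (c : local_map V M).
Hypothesis s_c : forall g, g \notin Es -> s g = c.

Local Notation Mc := (cod [seq pt (val m) | m : M]).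
Local Notation Ec := (cod [seq cod [:: pt g; code_local_map (s g)] | g <- Es]).
Local Notation cc := (code_local_map c).

(** The exceptional sites form an arbitrary list [Es], so that the empty list covers the uniform
    automaton. *)
Lemma eval_codeE k X t g :
  eval_code d n u k Mc Ec cc X t (pt g) = code_elt (iter k (nuca s) (conf_of X t) g).
Proof.
elim: k g => [|k IH] g; first by rewrite conf_ofE.
rewrite /= CodeSeq.codeK -map_comp nucaE -lookupE; congr lookup.
  congr cod; apply: eq_map => m /=.
  by rewrite point_addE IH ffunE.
rewrite assocE; case: ifP => // /negbT gE.
by rewrite s_c.
Qed.

Lemma ball_codeE k : ball_code d k Mc = cod [seq pt b | b <- ball M k].
Proof.
elim: k => [|k IH]; first by rewrite /= pt0.
rewrite /ball_code -/(ball_code d k Mc) IH /= map_cat !CodeSeq.codeK; congr (cod (_ ++ _)).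
rewrite map_flatten -!map_comp; congr flatten; apply: eq_map => m /=.
rewrite CodeSeq.codeK -!map_comp; apply: eq_map => b /=.
by rewrite point_addE.
Qed.

End Data.

Section Tests.

Variables (M E : {fset lattice d}) (s : lattice d -> local_map V M) (c : local_map V M).
Hypothesis d0 : 0 < d.
Hypothesis s_hom : forall g, is_grp_hom (s g).
Hypothesis s_c : coincide_outside E s (fun=> c).

Local Notation Mc := (cod [seq pt (val m) | m : M]).
Local Notation Ec := (cod [seq cod [:: pt g; code_local_map (s g)] | g <- enum_fset E]).
Local Notation cc := (code_local_map c).

Lemma influence_codeE k : influence_code d k Mc Ec = cod [seq pt b | b <- influence M E k].
Proof.
rewrite /influence_code ball_codeE !CodeSeq.codeK; congr cod.
rewrite map_flatten -!map_comp; congr flatten; apply: eq_map => e /=.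
rewrite !CodeSeq.codeK -!map_comp; apply: eq_map => b /=.
by rewrite point_subE.
Qed.

Lemma iter_eq_testP k l : l <= k ->
  reflect (iter k (nuca (fun=> c)) =1 iter l (nuca (fun=> c)))
    (iter_eq_test d n u k l Mc cc).
Proof.
move=> lk; pose z : G := 0%R.
have e0 j X t : eval_code d n u j Mc 0 cc X t (cod (nseq d 0)) =
    code_elt (iter j (nuca (fun=> c)) (conf_of X t) 0%R).
  by rewrite -pt0 -(@eval_codeE M [::] (fun=> c) c).
rewrite /iter_eq_test ball_codeE; apply: (iffP allP) => [H x|e t _]; last first.
  by rewrite !e0 e.
apply: functional_extensionality => g.
have cF j := gca_iter j (gca_nuca d0 s_hom s_c).
rewrite -[g]add0r -!(gca_shift (cF _)); move: (fun h => x (h + g)%R) => {}x.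
have [t tb tx] := conf_code_bounded x (ball M k).
have loc j : j <= k -> iter j (nuca (fun=> c)) x 0%R =
    iter j (nuca (fun=> c)) (conf_of (cod [seq pt b | b <- ball M k]) t) 0%R.
  move=> jk; apply: iter_nuca_local => b bj; rewrite add0r tx //.
  exact: ball_leq jk _ bj.
have := H t tb; rewrite !e0 => /eqP/code_elt_inj.
by rewrite -!loc.
Qed.

Lemma kernel_testP k :
  reflect (forall x : conf, (forall g, g \notin influence M E k -> x g = 1%g) ->
      {in influence M E k, forall g, iter k (nuca s) x g = 1%g} -> x = fun=> 1%g)
    (kernel_test d n u k Mc Ec cc).
Proof.
rewrite /kernel_test influence_codeE; set I := influence M E k.
have s_c' g : g \notin enum_fset E -> s g = c by exact: s_c.
apply: (iffP allP) => [H x xout xin|H t _].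
  (* A configuration supported in [I] equals its decoded copy everywhere, since both are trivial
     outside [I]. *)
  have [t tb tx] := conf_code_bounded x I.
  have ex : conf_of (cod [seq pt b | b <- I]) t = x.
    apply: functional_extensionality => g; have [gI|gI] := boolP (g \in I); first exact: tx.
    by rewrite xout // conf_of_out.
  have := H t tb; rewrite CodeSeq.codeK => /orP[/negP[]|/allP H'].
    by apply/allP => _ /mapP[g gI ->]; rewrite eval_codeE // ex xin.
  apply: functional_extensionality => g.
  have [gI|gI] := boolP (g \in I); last exact: xout.
  have /eqP := H' _ (map_f pt gI); rewrite -conf_ofE ex; exact: code_elt_inj.
rewrite CodeSeq.codeK -implybE; apply/implyP => /allP Hev.
have x1 : conf_of (cod [seq pt b | b <- I]) t = fun=> 1%g.
  apply: H => h hI; first exact: conf_of_out.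
  apply: code_elt_inj; rewrite -(eval_codeE s_c'); apply/eqP; apply: Hev.
  exact: map_f.
by apply/allP => _ /mapP[g gI ->]; rewrite -conf_ofE x1.
Qed.

End Tests.

End Correct.

Theorem theorem7p5 (d : nat) (V : finGroupType) (hd : 1 <= d) :
  (exists A : recfun,
     forall (M E : {fset lattice d}) (s : lattice d -> local_map V M)
       (c : local_map V M),
       (forall g, is_grp_hom (s g)) ->
       coincide_outside E s (fun=> c) ->
       decides A (code_data E s c) (periodic (nuca s)))
  /\
  (exists A : recfun,
     forall (M E : {fset lattice d}) (s : lattice d -> local_map V M)
       (c : local_map V M),
       (forall g, is_grp_hom (s g)) ->
       coincide_outside E s (fun=> c) ->
       decides A (code_data E s c) (eventually_periodic (nuca s))).
Proof.
(* [N] depends on [d] and [V] only, so it is built into the programs. *)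
have [N N0 bN] := bounded_evper_all d V; set u := code_elt (1%g : V).
have cD i : computable 1 (fun v => nth 0 (dec (nth 0 v 0)) i).
  by apply: computable_nthl; [exact: computable_const | exact: computable_nth].
split.
(* Exponents [N] and 0 test that the [N]-th iterate of the uniform automaton is the identity. *)
- have [A rA] := computable_and (computable_iter_eq_test d #|V| u N 0 (cD 0) (cD 2))
    (computable_kernel_test d #|V| u N (cD 0) (cD 1) (cD 2)).
  exists A => M E s c s_hom s_c.
  have /= := rA [:: code_data E s c] erefl; rewrite /code_data CodeSeq.codeK /=.
  have := perP hd s_hom s_c N0 bN.
  case: (iter_eq_testP hd s_hom s_c (leq0n N)) => H1; last by split=> // /H[].
  case: (kernel_testP s_c N) => H2 H; last by split=> // /H[].
  by split=> // nP; case: nP; apply/H.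
have [A rA] := computable_iter_eq_test d #|V| u (N + N) N (cD 0) (cD 2).
exists A => M E s c s_hom s_c.
have /= := rA [:: code_data E s c] erefl; rewrite /code_data CodeSeq.codeK /=.
have := ev_perP hd s_hom s_c N0 bN.
case: (iter_eq_testP hd s_hom s_c (leq_addr N N)) => H1 H; last by split=> // /H.
by split=> // nP; case: nP; apply/H.
Qed.
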